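(* Let $(u_1,m_1)$ and $(u_2,m_2)$ be two solutions of the MFG system $$\left\{\begin{array}{l}-\partial_t u-\Delta u+H(x,Du)=f(x,m(t))\ \text{ in }\mathbb T^d\times(t_0,T),\\ \partial_t m-\Delta m-\mathrm{div}(mD_pH(x,Du))=0\ \text{ in }\mathbb T^d\times(t_0,T),\\ m(x,t_0)=m_0(x),\quad u(x,T)=g(x,m(T))\ \text{ in }\mathbb T^d,\end{array}\right.$$ with the same initial condition for the measure $m_1(t_0)=m_2(t_0)=m_0$ and the same initial vector field $Du_1(\cdot,t_0)=Du_2(\cdot,t_0)$ in $\mathbb T^d$. Then $(u_1,m_1)=(u_2,m_2)$ on $\mathbb T^d\times[t_0,T]$.
   Context: Notation: $\mathbb T^d=\mathbb R^d/\mathbb Z^d$; $T>0$ is a finite horizon, $t_0\in[0,T]$; $\mathcal P(\mathbb T^d)$ is the set of Borel probability measures on $\mathbb T^d$ endowed with the Monge--Kantorovich distance $\mathbf d_1$; measures with a density are identified with their density, and $m_0$ is a given probability density on $\mathbb T^d$. $D,\Delta,\mathrm{div}$ are taken in the space variable. Solutions of the MFG system are understood in the classical sense, with $m(t)\in\mathcal P(\mathbb T^d)$. Derivative on $\mathcal P(\mathbb T^d)$: $U:\mathcal P(\mathbb T^d)\to\mathbb R$ is $C^1$ if there is a continuous map $\frac{\delta U}{\delta m}:\mathbb T^d\times\mathcal P(\mathbb T^d)\to\mathbb R$ with $U(m')-U(m)=\int_0^1\int_{\mathbb T^d}\frac{\delta U}{\delta m}(x,(1-t)m+tm')(m'-m)(dx)\,dt$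 for all $m,m'$; it is normalized by $\int_{\mathbb T^d}\frac{\delta U}{\delta m}(x,m)\,dm(x)=0$. For $f(x,\cdot)$ and $g(x,\cdot)$ the derivatives are written $\frac{\delta f}{\delta m}(x,m,y)$, $\frac{\delta g}{\delta m}(x,m,y)$. Standing assumptions: $H:\mathbb T^d\times\mathbb R^d\to\mathbb R$ is of class $C^2$ and, for some $C>0$, $C^{-1}I_d\le D^2_{pp}H(x,p)\le CI_d$ for all $(x,p)$. The functions $f,g:\mathbb T^d\times\mathcal P(\mathbb T^d)\to\mathbb R$ are globally Lipschitz continuous, with space derivatives $\partial_{x_i}f,\partial_{x_i}g,\partial^2_{x_ix_j}g$ also Lipschitz continuous on $\mathbb T^d\times\mathcal P(\mathbb T^d)$, and $\frac{\delta f}{\delta m},\frac{\delta g}{\delta m}:\mathbb T^d\times\mathcal P(\mathbb T^d)\times\mathbb T^d\to\mathbb R$ are Lipschitz continuous. *)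

(* Defs.v *)
From HB Require Import structures.
From mathcomp Require Import all_boot all_order all_algebra archimedean.
From mathcomp Require Import generic_quotient.
From mathcomp Require Import all_classical all_reals all_analysis.

Set Implicit Arguments.
Unset Strict Implicit.
Unset Printing Implicit Defensive.

Import Order.TTheory GRing.Theory Num.Theory.
Import numFieldNormedType.Exports.

Local Open Scope quotient_scope.
Local Open Scope classical_set_scope.
Local Open Scope ring_scope.

Section Torus.
Variables (R : realType) (d : nat).

Definition lattice_rel (x y : 'rV[R]_d) : bool :=
  [forall i, (x ord0 i - y ord0 i) \is a Num.int].

Lemma lattice_refl : reflexive lattice_rel.
Proof. by move=> x; apply/forallP => i; rewrite subrr rpred0. Qed.

Lemma lattice_sym : symmetric lattice_rel.
Proof.
by move=> x y; apply/forallP/forallP => h i; rewrite -opprB rpredN.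
Qed.

Lemma lattice_trans : transitive lattice_rel.
Proof.
move=> y x z /forallP xy /forallP yz; apply/forallP => i.
by rewrite -(subrKA (y ord0 i)) rpredD.
Qed.

Canonical lattice_equiv :=
  EquivRel lattice_rel lattice_refl lattice_sym lattice_trans.

Definition torus : Type := quotient_topology {eq_quot lattice_equiv}.

HB.instance Definition _ :=
  PointedTopological.copy torus (quotient_topology {eq_quot lattice_equiv}).
HB.instance Definition _ :=
  Quotient.copy torus (quotient_topology {eq_quot lattice_equiv}).

HB.instance Definition _ := Measurable.copy torus
  (g_sigma_algebraType (@open torus)).

Definition tproj (a : 'rV[R]_d) : torus := \pi_torus a.

End Torus.

Section Lebesgue.
Variable R : realType.

Definition cons_tuple n (z : measurableTypeR R * n.-tuple (measurableTypeR R)) :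
  n.+1.-tuple (measurableTypeR R) := [tuple of z.1 :: z.2].

Lemma measurable_cons_tuple n : measurable_fun setT (@cons_tuple n).
Proof. exact: measurable_cons. Qed.

HB.instance Definition _ n :=
  isMeasurableFun.Build _ _ _ _ (@cons_tuple n) (@measurable_cons_tuple n).

(* The uniform law on [0, 1] is Lebesgue measure restricted to [0, 1], so this
   is Lebesgue measure on the unit cube [0, 1]^n. *)
Fixpoint cube_prob n : probability (n.-tuple (measurableTypeR R)) R :=
  if n is k.+1 then
    distribution (uniform_prob (@ltr01 R) \x cube_prob k)%E (@cons_tuple k)
  else \d_ [tuple].

Variable d : nat.

Definition tuple_torus (t : d.-tuple (measurableTypeR R)) : torus R d :=
  tproj (\row_i (tnth t i : R)).

Lemma measurable_tuple_torus : measurable_fun setT tuple_torus.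
Proof.
apply: (@measurability _ _ _ _ setT tuple_torus (@open (torus R d))) => //.
move=> _ [U oU <-]; rewrite setTI.
pose V : set 'rV[R]_d := @tproj R d @^-1` U.
have oV : open V by exact: oU.
pose box (p : d.-tuple rat * nat) := [set x : d.-tuple (measurableTypeR R) |
  forall i, `|(tnth x i : R) - ratr (tnth p.1 i)| < p.2.+1%:R^-1].
pose good (p : d.-tuple rat * nat) := forall x : 'rV[R]_d,
  (forall i, `|x ord0 i - ratr (tnth p.1 i)| < p.2.+1%:R^-1) -> V x.
have -> : tuple_torus @^-1` U =
    \bigcup_p (if `[<good p>] then box p else set0).
  apply/seteqP; split => [t Ut|t [p _]]; last first.
    case: asboolP => // gp bp; apply: gp => i; rewrite mxE; exact: bp.
  have : nbhs (\row_i (tnth t i : R)) V by apply: open_nbhs_nbhs; split.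
  move=> /nbhs_ballP[e /= e0 eV].
  have [k ke] : exists k : nat, k.+1%:R^-1 < e / 2.
    exists (Num.trunc (e / 2)^-1); rewrite invf_plt ?posrE ?divr_gt0//.
    by rewrite truncnS_gt.
  have k0 : (0 : R) < k.+1%:R^-1 by rewrite invr_gt0 ltr0n.
  have /choice[q qP] : forall i : 'I_d, exists q : rat,
      `|(tnth t i : R) - ratr q| < k.+1%:R^-1.
    move=> i; have /rat_in_itvoo[q] :
      (tnth t i : R) - k.+1%:R^-1 < (tnth t i : R) + k.+1%:R^-1.
      by rewrite ltrBlDr -addrA ltrDl addr_gt0.
    by rewrite in_itv/= => qt; exists q; rewrite ltr_distlC.
  exists ([tuple q i | i < d], k) => //; case: asboolP => [_ i|[]] /=.
    by rewrite tnth_mktuple.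
  move=> x xq; apply: eV; rewrite -ball_normE /ball_/= /Num.Def.normr/= mx_normrE.
  apply/bigmax_ltP; split => //= -[i j] _; rewrite ord1 !mxE.
  have := xq j; rewrite tnth_mktuple /= => xqj.
  rewrite -(subrKA (ratr (q j))) (le_lt_trans (ler_normD _ _))//.
  by rewrite (splitr e) ltrD// ?(lt_trans (qP j))// distrC (lt_trans xqj).
apply: countable_bigcupT_measurable => // p; case: asboolP => // _.
rewrite (_ : box p = \bigcap_(i in [set: 'I_d])
    [set x | `|(tnth x i : R) - ratr (tnth p.1 i)| < p.2.+1%:R^-1]); last first.
  by apply/seteqP; split => x /= h i; [move=> _|]; exact: h.
apply: fin_bigcap_measurable => // i _.
have := @measurable_tnth _ (measurableTypeR R) d i measurableT
  [set` `]ratr (tnth p.1 i) - p.2.+1%:R^-1, ratr (tnth p.1 i) + p.2.+1%:R^-1[]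
  (measurable_itv _).
rewrite setTI; congr (measurable _); apply/seteqP.
by split => x /=; rewrite in_itv/= ltr_distl.
Qed.

HB.instance Definition _ :=
  isMeasurableFun.Build _ _ _ _ tuple_torus measurable_tuple_torus.

Definition torus_lebesgue : probability (torus R d) R :=
  distribution (cube_prob d) tuple_torus.

End Lebesgue.

Section Mixture.
Context dp (T : measurableType dp) (R : realType) (mu nu : probability T R).

Definition clip01 (s : R) : R := Num.max 0 (Num.min s 1).

Lemma clip01_ge0 s : 0 <= clip01 s.
Proof. by rewrite le_max lexx. Qed.

Lemma onem_clip01_ge0 s : 0 <= 1 - clip01 s.
Proof. by rewrite subr_ge0 ge_max ler01 ge_min lexx orbT. Qed.

(* (1 - s) mu + s nu for 0 <= s <= 1; other values of s are clipped *)
Definition mixture (s : R) : set T -> \bar R :=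
  measure_add (mscale (NngNum (onem_clip01_ge0 s)) mu)
              (mscale (NngNum (clip01_ge0 s)) nu).

HB.instance Definition _ s := Measure.on (mixture s).

Lemma mixture_setT s : mixture s setT = 1%E.
Proof.
rewrite /mixture measure_addE.
transitivity ((1 - clip01 s)%:E * mu setT + (clip01 s)%:E * nu setT)%E => //.
by rewrite !probability_setT !mule1 -EFinD subrK.
Qed.

HB.instance Definition _ s :=
  Measure_isProbability.Build _ _ _ (mixture s) (mixture_setT s).

End Mixture.

Section TorusCalculus.
Variables (R : realType) (d : nat).
Local Notation TT := (torus R d).
Local Notation ee i := (delta_mx ord0 i : 'rV[R]_d).

(* Functions on the torus are differentiated through their periodic lifts; by
   periodicity the choice of a representative does not matter. *)
Definition tderivable (i : 'I_d) (phi : TT -> R) (x : TT) : Prop :=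
  derivable (phi \o @tproj R d) (repr x) (ee i).

Definition tpartial (i : 'I_d) (phi : TT -> R) (x : TT) : R :=
  'D_(ee i) (phi \o @tproj R d) (repr x).

Definition grad (phi : TT -> R) (x : TT) : 'rV[R]_d :=
  \row_i tpartial i phi x.

Definition laplacian (phi : TT -> R) (x : TT) : R :=
  \sum_i tpartial i (tpartial i phi) x.

Definition divergence (V : TT -> 'rV[R]_d) (x : TT) : R :=
  \sum_i tpartial i (fun y => V y ord0 i) x.

Definition grad_p (H : TT -> 'rV[R]_d -> R) (x : TT) (p : 'rV[R]_d) :
  'rV[R]_d := \row_i 'D_(ee i) (H x) p.

Definition hessian_p (H : TT -> 'rV[R]_d -> R) (x : TT) (p : 'rV[R]_d) :
  'M[R]_d := \matrix_(i, j) 'D_(ee i) (fun q => 'D_(ee j) (H x) q) p.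

Definition loewner_le (A B : 'M[R]_d) : Prop :=
  forall xi : 'rV[R]_d,
    (xi *m A *m xi^T) ord0 ord0 <= (xi *m B *m xi^T) ord0 ord0.

Definition class_C1 (F : TT -> 'rV[R]_d -> R) : Prop :=
  continuous (fun z : TT * 'rV[R]_d => F z.1 z.2) /\
  forall i,
    [/\ forall x p, tderivable i (F ^~ p) x,
        forall x p, derivable (F x) p (ee i),
        continuous (fun z : TT * 'rV[R]_d => tpartial i (F ^~ z.2) z.1) &
        continuous (fun z : TT * 'rV[R]_d => 'D_(ee i) (F z.1) z.2)].

Definition class_C2 (F : TT -> 'rV[R]_d -> R) : Prop :=
  class_C1 F /\
  forall i, class_C1 (fun x p => tpartial i (F ^~ p) x) /\
            class_C1 (fun x p => 'D_(ee i) (F x) p).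

Definition hamiltonian (H : TT -> 'rV[R]_d -> R) : Prop :=
  class_C2 H /\
  exists2 C : R, 0 < C &
    forall x p, loewner_le (C^-1)%:M (hessian_p H x p) /\
                loewner_le (hessian_p H x p) C%:M.

End TorusCalculus.

Section ProbabilityMeasures.
Variables (R : realType) (d : nat).
Local Notation TT := (torus R d).
Local Notation PP := (probability (torus R d) R).

(* `|v| is the maximum norm in the library. *)
Definition enorm (v : 'rV[R]_d) : R := Num.sqrt (\sum_i v ord0 i ^+ 2).

Definition tdist (x y : TT) : R :=
  inf [set r | exists a b, [/\ tproj a = x, tproj b = y & r = enorm (a - b)]].

(* Monge--Kantorovich distance, in its Kantorovich--Rubinstein form *)
Definition d1 (mu nu : PP) : R :=
  sup [set r | exists2 phi : TT -> R,
    forall x y, `|phi x - phi y| <= tdist x y &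
    r = \int[mu]_x phi x - \int[nu]_x phi x].

Definition lipschitz_TP (h : TT -> PP -> R) : Prop :=
  exists L : R, forall x y mu nu,
    `|h x mu - h y nu| <= L * (tdist x y + d1 mu nu).

Definition lipschitz_TPT (h : TT -> PP -> TT -> R) : Prop :=
  exists L : R, forall x x' mu nu y y',
    `|h x mu y - h x' nu y'| <= L * (tdist x x' + d1 mu nu + tdist y y').

Definition continuous_TP (h : TT -> PP -> R) : Prop :=
  forall x mu eps, 0 < eps -> exists2 delta, 0 < delta &
    forall y nu, tdist x y < delta -> d1 mu nu < delta ->
      `|h x mu - h y nu| < eps.

Definition is_measure_derivative (U : PP -> R) (dU : TT -> PP -> R) : Prop :=
  [/\ continuous_TP dU,
      forall m m' : PP, U m' - U m =
        \int[lebesgue_measure]_(s in `[0, 1])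
          (\int[m']_x dU x (mixture m m' s) - \int[m]_x dU x (mixture m m' s)) &
      forall m : PP, \int[m]_x dU x m = 0].

(* df x m y stands for (delta f / delta m)(x, m, y); the normalization makes it
   unique. *)
Definition coupling_C1 (f : TT -> PP -> R) : Prop :=
  [/\ lipschitz_TP f,
      forall i, (forall x mu, tderivable i (f ^~ mu) x) /\
        lipschitz_TP (fun x mu => tpartial i (f ^~ mu) x) &
      exists df : TT -> PP -> TT -> R,
        (forall x, is_measure_derivative (f x) (fun y m => df x m y)) /\
        lipschitz_TPT df].

Definition coupling_C2 (g : TT -> PP -> R) : Prop :=
  coupling_C1 g /\
  forall i j, (forall x mu, tderivable i (tpartial j (g ^~ mu)) x) /\
    lipschitz_TP (fun x mu => tpartial i (tpartial j (g ^~ mu)) x).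

Definition is_density (m : TT -> R) : Prop :=
  [/\ measurable_fun setT m, forall x, 0 <= m x &
      (\int[torus_lebesgue R d]_x (m x)%:E = 1)%E].

Definition has_density (mu : PP) (m : TT -> R) : Prop :=
  is_density m /\
  forall A, measurable A -> mu A = (\int[torus_lebesgue R d]_(x in A) (m x)%:E)%E.

End ProbabilityMeasures.

Section MeanFieldGame.
Variables (R : realType) (d : nat).
Local Notation TT := (torus R d).
Local Notation PP := (probability (torus R d) R).

Definition continuous_TX (I : set R) (w : R -> TT -> R) : Prop :=
  {within I `*` [set: TT], continuous (fun z : R * TT => w z.1 z.2)}.

Definition class_C12 (I : set R) (w : R -> TT -> R) : Prop :=
  [/\ (forall t x, I t -> derivable (w ^~ x) t 1) /\
        continuous_TX I (fun t x => 'D_1 (w ^~ x) t),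
      forall i, (forall t x, I t -> tderivable i (w t) x) /\
        continuous_TX I (fun t => tpartial i (w t)) &
      forall i j, (forall t x, I t -> tderivable i (tpartial j (w t)) x) /\
        continuous_TX I (fun t => tpartial i (tpartial j (w t)))].

(* Classical solution: u and m are continuous up to the initial and final times
   and C^{1,2} in between; Du is moreover continuous up to t0, so that
   Du(., t0) is meaningful.  mu t is the element of P(T^d) with density m t. *)
Definition mfg_solution (H : TT -> 'rV[R]_d -> R) (f g : TT -> PP -> R)
    (t0 T : R) (m0 : TT -> R) (u m : R -> TT -> R) : Prop :=
  exists mu : R -> PP,
  [/\ [/\ continuous_TX `[t0, T] u, class_C12 `]t0, T[ u &
          forall i, (forall t x, t0 <= t < T -> tderivable i (u t) x) /\
            continuous_TX `[t0, T[ (fun t => tpartial i (u t))],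
      continuous_TX `[t0, T] m /\ class_C12 `]t0, T[ m,
      forall t, t0 <= t <= T -> has_density (mu t) (m t),
      forall t x, t0 < t < T ->
        - 'D_1 (u ^~ x) t - laplacian (u t) x + H x (grad (u t) x)
          = f x (mu t) /\
        'D_1 (m ^~ x) t - laplacian (m t) x
          - divergence (fun y => m t y *: grad_p H y (grad (u t) y)) x = 0 &
      (forall x, m t0 x = m0 x) /\ (forall x, u T x = g x (mu T))].

End MeanFieldGame.

(* Main.v *)
Require Import Defs.
From mathcomp Require Import all_boot all_order all_algebra archimedean.
From mathcomp Require Import all_classical all_reals all_analysis measurable_realfun.
From mathcomp Require Import ring lra.

(** Subtract the two solutions. The difference u1 - u2 has zero gradient at t0,
    hence is a constant c there; put v = u1 - u2 - c, n = m1 - m2 and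
    A = - Laplacian. Then v(t0) = 0, n(t0) = 0 and

      v' = A v + h   with   |h| <= C (|Dv| + |n|_2)   pointwise:

    the Hamiltonian is Lipschitz in p on the bounded set of gradients, the
    coupling f is Lipschitz for d1, and d1 is at most a constant times the L^1
    distance of the densities. The equation for n is in divergence form, with a
    flux difference bounded by a multiple of |n| + |Dv|.

    In terms of P = |v|^2, E = |Dv|^2 = <Av, v> and k = |n|^2 (norms in L^2),

      P' = 2 E + 2 <h, v>,   E' = 2 <Av, Av> + 2 <h, Av>,   k' <= C (E + k).

    The first equation is parabolic in the wrong direction of time, so that
    Gronwall's lemma says nothing about P; this is a backward uniqueness
    problem. It is solved by a weight: if phi' = psi with
    psi(t) = lam exp(- 2 g t) - g, then, for a suitable g, a small th, and every
    large lam,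

      J = exp(- 2 phi) (E - (psi - g) P - th k)

    is nondecreasing, because its derivative contains the square of
    Av + h/2 - psi v. As J(t0) = 0, this yields (psi - g) P + th k <= E, and
    lam -> oo forces P = 0 on the whole interval; then E = 0 and k = 0. The
    memory that the forward equation introduces is harmless for this argument,
    since k enters J with the favourable sign. This is [carleman_gronwall].

    The bounds on gradients hold on [t0, t1] for every t1 < T, so v and n vanish
    before T and, by continuity, at T. There m1 = m2, the terminal condition
    gives u1 = u2, and c = 0.

    The rest provides the analysis behind these lines. Integration by parts
    comes from the fundamental theorem of calculus in one variable of the cube
    ([cube_derive]). The energy E is differentiable in time although Dv need
    not be, because E(s) - E(t) = <v(s) - v(t), A (v(s) + v(t))>
    ([tint_is_derive], [dirichlet_is_derive]). The chain rule
    [C1_chain_rule] shows that the flux has the partial derivatives that its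
    divergence refers to, and [d1_le_L1] compares the distance of measures with
    that of densities. *)

Set Implicit Arguments.
Unset Strict Implicit.
Unset Printing Implicit Defensive.

Import Order.TTheory GRing.Theory Num.Theory.
Import numFieldNormedType.Exports.

Local Open Scope classical_set_scope.
Local Open Scope ring_scope.

(** * A differential inequality of Carleman type *)

Lemma is_derive_expRM (R : realType) (f : R -> R) (t df : R) :
  is_derive t 1 f df -> is_derive t 1 (fun s => expR (f s)) (expR (f t) * df).
Proof.
move=> fd; have := @is_derive1_comp R expR f t _ _ (is_derive_expR (f t)) fd.
by [].
Qed.

(** The derivative of exp (- 2 phi) (E - psi P + g P - k / C), up to the
    exponential, when phi' = psi and psi' = - 2 g (psi + g). It equals twice the
    first quadratic form, plus half of the second one, plus 2 g E and terms in hh,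
    dk and k; since 2 g = C + 2, the term 2 g E pays for hh and dk, and a large psi
    pays for what is left in k. *)
Lemma carleman_integrand (R : realFieldType) (C psi g B c e hh P E k dk : R) :
  0 < C -> 2 * g = C + 2 -> C * (C + 1) <= 2 * psi -> 0 <= E -> 0 <= k ->
  E = c - e / 2 -> 0 <= B - 2 * psi * c + psi ^+ 2 * P ->
  0 <= hh + 4 * g * e + 4 * g ^+ 2 * P ->
  hh <= C * (E + k) -> dk <= C * (E + k) ->
  0 <= (2 * B - hh / 2) + 2 * g * (psi + g) * P + (g - psi) * (2 * c + e)
       - C^-1 * dk - 2 * psi * (E - psi * P + g * P - C^-1 * k).
Proof.
move=> C0 gE psiC E0 k0 Ec q1 q2 hhle dkle.
have dk1 : C^-1 * dk <= E + k by rewrite mulrC ler_pdivrMr// mulrC.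
have psi1 : (C + 1) * k <= 2 * psi * (C^-1 * k).
  rewrite mulrA ler_wpM2r// ler_pdivlMr//; nra.
have cE : c = E + e / 2 by rewrite Ec subrK.
suff -> : (2 * B - hh / 2) + 2 * g * (psi + g) * P + (g - psi) * (2 * c + e)
       - C^-1 * dk - 2 * psi * (E - psi * P + g * P - C^-1 * k) =
   2 * (B - 2 * psi * c + psi ^+ 2 * P)
   + (hh + 4 * g * e + 4 * g ^+ 2 * P) / 2
   + (C * (E + k) - hh) + (E + k - C^-1 * dk)
   + (2 * psi * (C^-1 * k) - (C + 1) * k) + E.
  by lra.
move: C^-1 => i in dk1 psi1 *.
have -> : C = 2 * g - 2 by rewrite gE addrK.
by rewrite cE; field.
Qed.

(** P, E and k are |v|^2, |Dv|^2 and |n|^2, where v' = A v + h. At each time B,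
    c, e and hh are |A v + h/2|^2, <A v + h/2, v>, <h, v> and |h|^2; the two
    families of quadratic forms are |A v + h/2 - psi v|^2 and |h + 2 g v|^2. The
    weighted functional J of the proof is nondecreasing for every large lam, and
    lam -> oo then leaves no room for P. *)
Lemma carleman_gronwall (R : realType) (a b C : R) (P E k : R -> R) :
  a < b -> 0 <= C ->
  {within `[a, b], continuous P} -> {within `[a, b], continuous E} ->
  {within `[a, b], continuous k} ->
  P a = 0 -> E a = 0 -> k a = 0 ->
  (forall t, a <= t <= b -> [/\ 0 <= P t, 0 <= E t & 0 <= k t]) ->
  (forall t, a < t < b -> exists B c e hh dk,
    [/\ is_derive t 1 P (2 * c + e), is_derive t 1 E (2 * B - hh / 2) &
        is_derive t 1 k dk] /\
    [/\ E t = c - e / 2, forall psi, 0 <= B - 2 * psi * c + psi ^+ 2 * P t,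
        forall g, 0 <= hh + 4 * g * e + 4 * g ^+ 2 * P t,
        hh <= C * (E t + k t) & dk <= C * (E t + k t)]) ->
  forall t, a < t < b -> P t = 0 /\ k t = 0.
Proof.
move=> ab C0 cP cE ck Pa Ea ka nng dyn.
(* A positive constant, since the weight of k is its inverse. *)
pose D := C + 1.
have D0 : 0 < D by rewrite ltr_wpDl.
pose g := (D + 2) / 2.
have g0 : 0 < g by rewrite divr_gt0// addr_gt0.
have gE : 2 * g = D + 2 by rewrite mulrC divfK.
pose w s := expR (- (2 * g) * s).
have w0 s : 0 < w s by exact: expR_gt0.
have dw s : is_derive s (1 : R) w (- (2 * g) * w s).
  rewrite [X in is_derive _ _ _ X]mulrC; apply: is_derive_expRM.
  by apply: is_derive_eq; rewrite /GRing.scale/= ?mulr1.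
have wb s : s <= b -> w b <= w s.
  by move=> sb; rewrite ler_expR ler_wnM2l// oppr_le0 mulr_ge0// ltW.
have key lam : D * (D + 1) + 2 * g <= 2 * lam * w b ->
    forall t, a <= t <= b -> (lam * w t - 2 * g) * P t + D^-1 * k t <= E t.
  move=> lamb.
  pose psi s := lam * w s - g.
  pose ph s := - 2 * (- (lam / (2 * g)) * w s - g * s).
  pose J s := expR (ph s) * (E s - psi s * P s + g * P s - D^-1 * k s).
  have lam0 : 0 <= lam.
    rewrite -(pmulr_lge0 _ (w0 b)) -(pmulr_rge0 _ (ltr0Sn R 1)) mulrA.
    apply: le_trans lamb; nra.
  have dpsi s : is_derive s (1 : R) psi (- (2 * g) * (psi s + g)).
    rewrite /psi; apply: is_derive_eq.
    rewrite subr0 subrK /GRing.scale/=; ring.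
  have dph s : is_derive s (1 : R) ph (- 2 * psi s).
    rewrite /ph /psi; apply: is_derive_eq.
    rewrite /GRing.scale/=; field; exact: lt0r_neq0.
  have dJ t : a < t < b -> exists2 dj, is_derive t 1 J dj & 0 <= dj.
    move=> tab; have tab' : a <= t <= b by case/andP: tab => *; rewrite !ltW.
    have [B [c [e [hh [dk [[dP dE dk'] [Ec q1 q2 hhle dkle]]]]]]] := dyn t tab.
    have [P0 E0 k0] := nng t tab'.
    have dQ : is_derive t 1
        (fun s => E s - psi s * P s + g * P s - D^-1 * k s)
        ((2 * B - hh / 2) + 2 * g * (psi t + g) * P t
         + (g - psi t) * (2 * c + e) - D^-1 * dk).
      by apply: is_derive_eq; rewrite /GRing.scale/=; ring.
    have dX := is_derive_expRM (dph t).
    exists (expR (ph t) * ((2 * B - hh / 2) + 2 * g * (psi t + g) * P t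
         + (g - psi t) * (2 * c + e) - D^-1 * dk
         - 2 * psi t * (E t - psi t * P t + g * P t - D^-1 * k t))).
      by rewrite /J; apply: is_derive_eq; rewrite /GRing.scale/=; ring.
    rewrite mulr_ge0 ?expR_ge0//; apply: (@carleman_integrand _ D _ _ _ _ _ hh) => //.
    - have := wb t; case/andP: tab' => _ tb /(_ tb) wbt.
      rewrite /psi mulrBr; have : 2 * lam * w b <= 2 * (lam * w t).
        by rewrite -mulrA !ler_wpM2l.
      by move: lamb; lra.
    - by rewrite (le_trans hhle)// ler_wpM2r ?addr_ge0// /D lerDl.
    - by rewrite (le_trans dkle)// ler_wpM2r ?addr_ge0// /D lerDl.
  have cJ : {within `[a, b], continuous J}.
    have cpsi : continuous psi.
      by move=> x; apply: differentiable_continuous; apply/derivable1_diffP.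
    have cph : continuous (expR \o ph).
      move=> x; apply: continuous_comp; last exact: continuous_expR.
      by apply: differentiable_continuous; apply/derivable1_diffP.
    move=> x; apply: cvgM; first exact: (continuous_subspaceT cph).
    apply: cvgB; last by apply: cvgMr; exact: ck.
    apply: cvgD; last by apply: cvgMr; exact: cP.
    apply: cvgB; first exact: cE.
    by apply: cvgM; [exact: (continuous_subspaceT cpsi)|exact: cP].
  have Ja : J a = 0 by rewrite /J Pa Ea ka !mulr0 !subr0 addr0 mulr0.
  move=> t /andP[at_ tb].
  have dJ1 x : x \in `]a, b[%R -> derivable J x 1.
    by rewrite in_itv/= => /dJ[dj [? _] _].
  have dJ2 x : x \in `]a, b[%R -> 0 <= J^`()%classic x.
    rewrite in_itv/= => /dJ[dj ddj dj0].
    by rewrite derive1E (@derive_val _ _ _ _ _ _ _ ddj).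
  have : J a <= J t.
    apply: (ger0_derive1_le_cc dJ1 dJ2 cJ) => //.
    - by rewrite in_itv/= lexx ltW.
    - by rewrite in_itv/= at_ tb.
  rewrite Ja /J pmulr_rge0 ?expR_gt0// /psi; lra.
have P0 t : a <= t <= b -> P t = 0.
  move=> tab; have [Pt Et kt] := nng t tab.
  apply/eqP; rewrite eq_le Pt andbT leNgt; apply/negP => Ptpos.
  (* Large enough for lam * w t - 2 * g to exceed E t / P t. *)
  pose lam := (D * (D + 1) + 4 * g + 1 + E t / P t) / w b.
  have lamw : lam * w b = D * (D + 1) + 4 * g + 1 + E t / P t.
    by rewrite divfK// gt_eqF.
  have EP0 : 0 <= E t / P t by rewrite divr_ge0.
  have lam0 : 0 <= lam by rewrite divr_ge0 ?ltW//; nra.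
  have /key/(_ _ tab) : D * (D + 1) + 2 * g <= 2 * lam * w b.
    rewrite -mulrA lamw; nra.
  apply/negP; rewrite -ltNge.
  have : 1 + E t / P t < lam * w t - 2 * g.
    have : lam * w b <= lam * w t by rewrite ler_wpM2l// wb//; case/andP: tab.
    by rewrite lamw; nra.
  rewrite -(ltr_pM2r Ptpos) mulrDl mul1r divfK ?gt_eqF// => h.
  have : 0 <= D^-1 * k t by rewrite mulr_ge0// invr_ge0 ltW.
  by move: h; lra.
move=> t tab; have tab' : a <= t <= b by case/andP: tab => *; rewrite !ltW.
split; first exact: P0.
have [B [c [e [hh [dk [[dP _ _] [Ec _ q2 _ _]]]]]]] := dyn t tab.
have [_ Et kt] := nng t tab'.
(* P vanishes around t, hence so does its derivative. *)
have ce : 2 * c + e = 0.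
  have : is_derive t 1 P 0.
    apply: (@near_eq_is_derive _ _ _ (cst 0)).
      have : t \in `]a, b[ by rewrite in_itv.
      move/near_in_itvoo; apply: filterS => s; rewrite in_itv/= => /andP[? ?].
      by rewrite P0// !ltW.
  by move=> [_ <-]; rewrite (@derive_val _ _ _ _ _ _ _ dP).
have e0 : e = 0.
  apply/eqP; apply: contraT => e0.
  (* This value of g makes the form equal to -1. *)
  have := q2 (- (hh + 1) / (4 * e)); rewrite P0// mulr0 addr0.
  have -> : 4 * (- (hh + 1) / (4 * e)) * e = - (hh + 1) by field.
  by lra.
have E0 : E t = 0 by rewrite Ec e0; move: ce; rewrite e0; lra.
pose lam := (D * (D + 1) + 2 * g) / w b.
have lamw : lam * w b = D * (D + 1) + 2 * g by rewrite divfK// gt_eqF.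
have /key/(_ _ tab') : D * (D + 1) + 2 * g <= 2 * lam * w b.
  rewrite -mulrA lamw; nra.
rewrite P0// mulr0 add0r E0 => k0; apply/eqP; rewrite eq_le kt andbT.
by rewrite -(pmulr_rle0 _ (_ : 0 < D^-1)) ?invr_gt0.
Qed.

(** * Calculus on the torus through periodic lifts *)

Lemma is_derive_line (R : realType) (V W : normedModType R) (F : V -> W)
    (a v : V) (s : R) (df : W) :
  is_derive (a + s *: v) v F df <->
  is_derive s 1 (fun r : R => F (a + r *: v)) df.
Proof.
have E : (fun h : R => h^-1 *: ((F \o shift (a + s *: v)) (h *: v) - F (a + s *: v)))
  = (fun h : R => h^-1 *: (((fun r : R => F (a + r *: v)) \o shift s) (h *: 1)
     - F (a + s *: v))).
  apply/funext => h /=; congr (_ *: (F _ - _)).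
  by rewrite scalerDl /GRing.scale/= mulr1 addrCA.
have E1 : derivable F (a + s *: v) v = derivable (fun r : R => F (a + r *: v)) s 1.
  exact: (congr1 (fun q : R -> W => cvg (q @ 0^')) E).
have E2 : 'D_v F (a + s *: v) = 'D_1 (fun r : R => F (a + r *: v)) s.
  exact: (congr1 (fun q : R -> W => lim (q @ 0^')) E).
by split => -[D <-]; split; rewrite ?E1 ?E2// -?E1 -?E2.
Qed.

Section Mvt.
Variables (R : realType) (n : nat).
Local Notation ee i := (delta_mx ord0 i : 'rV[R]_n).

Lemma mvt_coord (F : 'rV[R]_n -> R) (i : 'I_n) (DF : 'rV[R]_n -> R)
    (x : 'rV[R]_n) (z : R) :
  (forall y, is_derive y (ee i) F (DF y)) ->
  exists2 c, 0 <= c <= 1 &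
    F (x + z *: ee i) - F x = z * DF (x + (c * z) *: ee i).
Proof.
move=> dF.
have dg (s : R) : is_derive s 1 (fun r => F (x + (r * z) *: ee i))
    (DF (x + (s * z) *: ee i) * z).
  have dz : is_derive s 1 ( *%R^~ z) z.
    have -> : ( *%R^~ z) = (fun r : R => z *: r) by apply/funext => r; rewrite mulrC.
    by apply: is_derive_eq; rewrite /GRing.scale/= mulr1.
  apply: (@is_derive1_comp _ (fun r => F (x + r *: ee i)) ( *%R^~ z) s _ _ _ dz).
    exact: (iffLR (is_derive_line F x (ee i) (s * z) _) (dF _)).
have [|c] := MVT_segment (@ler01 R) (fun s _ => dg s).
  by apply: derivable_within_continuous => s _; have [] := dg s.
rewrite in_itv/= => c01; rewrite subr0 mulr1 mul1r mul0r scale0r addr0 => ->.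
by exists c => //; rewrite mulrC.
Qed.

(** Going from p to q one coordinate at a time uses partial derivatives only, and
    every intermediate point stays in the box spanned by p and q. This does the work
    of total differentiability for Lipschitz bounds, for the chain rule and for
    functions with zero gradient. *)
Lemma mvt_telescope (F : 'rV[R]_n -> R) (DF : 'I_n -> 'rV[R]_n -> R) :
  (forall i y, is_derive y (ee i) F (DF i y)) ->
  forall p q : 'rV[R]_n, exists xi : 'I_n -> 'rV[R]_n,
    (forall i j, `|xi i ord0 j - p ord0 j| <= `|q ord0 j - p ord0 j|) /\
    F q - F p = \sum_i (q ord0 i - p ord0 i) * DF i (xi i).
Proof.
move=> dF p q.
pose mix (k : nat) := \row_j (if (j < k)%N then q ord0 j else p ord0 j).
have mixS (i : 'I_n) : mix i.+1 = mix i + (q ord0 i - p ord0 i) *: ee i.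
  apply/rowP => j; rewrite !mxE ltnS leq_eqVlt eqxx/= -val_eqE/=.
  case: ltngtP => //= [_|_|/val_inj ->]; rewrite ?mulr0 ?addr0 ?mulr1//.
  by rewrite addrC subrK.
have /choice[c cP] : forall i : 'I_n, exists c, 0 <= c <= 1 /\
    F (mix i.+1) - F (mix i) = (q ord0 i - p ord0 i) *
      DF i (mix i + (c * (q ord0 i - p ord0 i)) *: ee i).
  move=> i; have [c c01 h] := mvt_coord (mix i) (q ord0 i - p ord0 i) (dF i).
  by exists c; rewrite mixS.
exists (fun i : 'I_n => mix i + (c i * (q ord0 i - p ord0 i)) *: ee i); split.
  move=> i j; rewrite !mxE eqxx/=; have [ji|ij] := eqVneq j i.
    rewrite ji ltnn mulr1 addrAC subrr add0r normrM.
    have [/andP[c0 c1] _] := cP i.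
    by rewrite ger0_norm// ler_piMl.
  by rewrite mulr0 addr0; case: ifP => // _; rewrite subrr normr0.
transitivity (F (mix n) - F (mix 0)).
  by congr (F _ - F _); apply/rowP => j; rewrite mxE ?ltn_ord.
rewrite -(telescope_sumr (F \o mix))// big_mkord.
by apply: eq_bigr => i _; have [_ <-] := cP i.
Qed.

End Mvt.

Section TorusTopology.
Variables (R : realType) (d : nat).
Local Notation TT := (torus R d).
Local Notation ee i := (delta_mx ord0 i : 'rV[R]_d).
Implicit Types a b : 'rV[R]_d.

Lemma tprojK (x : TT) : tproj (repr x) = x.
Proof. exact: reprK. Qed.

Lemma tproj_eqP a b :
  tproj a = tproj b <-> forall i, (a ord0 i - b ord0 i) \is a Num.int.
Proof.
have E := @eqmodP _ (lattice_equiv R d) a b.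
split => [h|h]; first by have /E/forallP : tproj a = tproj b by exact: h.
by apply/E/forallP.
Qed.

Lemma tproj_addr a b c : tproj a = tproj b -> tproj (c + a) = tproj (c + b).
Proof.
move=> /tproj_eqP h; apply/tproj_eqP => i; have := h i.
by rewrite !mxE opprD addrACA subrr add0r.
Qed.

Lemma tproj_continuous : continuous (@tproj R d).
Proof. exact: pi_continuous. Qed.

Lemma continuous_torusP (Z : topologicalType) (phi : TT -> Z) :
  continuous phi <-> continuous (phi \o @tproj R d).
Proof. exact: quotient_continuous. Qed.

Lemma tproj_unit_cube (x : TT) :
  exists2 a : 'rV[R]_d, tproj a = x & forall i, 0 <= a ord0 i <= 1.
Proof.
exists (\row_i (repr x ord0 i - (Num.floor (repr x ord0 i))%:~R)).
  rewrite -[RHS]tprojK; apply/tproj_eqP => i; rewrite mxE.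
  by rewrite addrAC subrr add0r rpredN intr_int.
move=> i; rewrite mxE subr_ge0 floor_le_tmp/= lerBlDr addrC.
by rewrite ltW// -intrD1 floorD1_gt.
Qed.

Lemma unit_cube_compact :
  compact [set a : 'rV[R]_d | forall i, a ord0 i \in `[0, 1]].
Proof.
have := @rV_compact _ d (fun=> `[(0 : R), 1]%classic).
by move/(_ (fun=> @segment_compact _ _ _)).
Qed.

Lemma torus_compact : compact [set: TT].
Proof.
have -> : [set: TT] = @tproj R d @` [set a : 'rV[R]_d | forall i, a ord0 i \in `[0, 1]].
  apply/seteqP; split => // x _; have [a ax a01] := tproj_unit_cube x.
  by exists a => // i /=; rewrite in_itv/=.
apply: continuous_compact; last exact: unit_cube_compact.
exact: continuous_subspaceT tproj_continuous.
Qed.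

(** Two representatives of a point differ by a period of the lift. *)
Lemma lift_quotient (phi : TT -> R) (v a : 'rV[R]_d) :
  derivable (phi \o @tproj R d) (repr (tproj a)) v =
    derivable (phi \o @tproj R d) a v /\
  'D_v (phi \o @tproj R d) (repr (tproj a)) = 'D_v (phi \o @tproj R d) a.
Proof.
have E : (fun h : R => h^-1 *: ((phi \o @tproj R d \o shift (repr (tproj a))) (h *: v)
      - (phi \o @tproj R d) (repr (tproj a)))) =
    (fun h : R => h^-1 *: ((phi \o @tproj R d \o shift a) (h *: v)
      - (phi \o @tproj R d) a)).
  apply/funext => h /=; rewrite tprojK; congr (_ *: (phi _ - _)).
  by apply: tproj_addr; rewrite tprojK.
split.
  exact: (congr1 (fun q : R -> R => cvg (q @ 0^')) E).
exact: (congr1 (fun q : R -> R => lim (q @ 0^')) E).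
Qed.

Lemma is_derive_lift (phi : TT -> R) (i : 'I_d) a :
  tderivable i phi (tproj a) ->
  is_derive a (ee i) (phi \o @tproj R d) (tpartial i phi (tproj a)).
Proof.
rewrite /tderivable /tpartial; have [E1 E2] := lift_quotient phi (ee i) a.
by rewrite E1 E2 => D; split.
Qed.

Lemma is_derive_repr (phi : TT -> R) (i : 'I_d) (x : TT) :
  tderivable i phi x ->
  is_derive (repr x) (ee i) (phi \o @tproj R d) (tpartial i phi x).
Proof. by move=> D; split. Qed.

Lemma tderivable_repr (phi : TT -> R) (i : 'I_d) (x : TT) (df : R) :
  is_derive (repr x) (ee i) (phi \o @tproj R d) df ->
  tderivable i phi x /\ tpartial i phi x = df.
Proof. by move=> [D <-]. Qed.

Lemma grad0_constant (phi : TT -> R) :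
  (forall i x, tderivable i phi x) -> (forall i x, tpartial i phi x = 0) ->
  forall x y, phi x = phi y.
Proof.
move=> dphi phi0 x y; rewrite -(tprojK x) -(tprojK y).
have [|xi [_ h]] := @mvt_telescope R d (phi \o @tproj R d)
   (fun=> cst 0) _ (repr y) (repr x).
  by move=> i a; have := is_derive_lift (dphi i (tproj a)); rewrite phi0.
apply/eqP; rewrite -subr_eq0; apply/eqP.
by rewrite h big1// => i _; rewrite mulr0.
Qed.

End TorusTopology.

(** * Lebesgue measure on the unit cube *)

Lemma integral_prob_cst dT (T : measurableType dT) (R : realType)
    (P : probability T R) (M : R) : (\int[P]_x (cst M%:E) x = M%:E)%E.
Proof.
rewrite integral_cst//; have -> : (P : {measure set T -> \bar R}) setT = 1%E.
  exact: probability_setT.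
by rewrite mule1.
Qed.

Section Cube.
Variable R : realType.
Local Notation mR := (measurableTypeR R).
Local Notation unif := (uniform_prob (@ltr01 R)).

Lemma integral_cubeS n (f : n.+1.-tuple mR -> \bar R) :
  measurable_fun setT f -> (forall t, 0 <= f t)%E ->
  (\int[cube_prob R n.+1]_t f t =
     \int[unif]_a \int[cube_prob R n]_t f (Defs.cons_tuple (a, t)))%E /\
  (\int[cube_prob R n.+1]_t f t =
     \int[cube_prob R n]_t \int[unif]_a f (Defs.cons_tuple (a, t)))%E.
Proof.
move=> mf f0.
have mfc : measurable_fun setT (f \o @Defs.cons_tuple R n).
  by apply: measurableT_comp => //; exact: measurable_cons_tuple.
have -> : (\int[cube_prob R n.+1]_t f t =
    \int[unif \x cube_prob R n]_z (f \o @Defs.cons_tuple R n) z)%E.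
  by rewrite [cube_prob R n.+1]/= ge0_integral_distribution.
have fc0 z : (0 <= (f \o @Defs.cons_tuple R n) z)%E by exact: f0.
split; first exact: (fubini_tonelli1 (m1 := unif) (m2 := cube_prob R n) _ mfc fc0).
exact: (fubini_tonelli2 (m1 := unif) (m2 := cube_prob R n) _ mfc fc0).
Qed.

Definition tset n (t : n.-tuple mR) (i : 'I_n) (s : R) : n.-tuple mR :=
  [tuple if j == i then s else tnth t j | j < n].

Lemma tset_cons0 n (a : mR) (t : n.-tuple mR) s :
  tset (Defs.cons_tuple (a, t)) ord0 s = Defs.cons_tuple (s, t).
Proof.
apply: eq_from_tnth => j; rewrite tnth_mktuple.
by case: (unliftP ord0 j) => [k|] -> //=; rewrite !tnthS.
Qed.

Lemma tset_consS n (a : mR) (t : n.-tuple mR) (i : 'I_n) s :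
  tset (Defs.cons_tuple (a, t)) (lift ord0 i) s = Defs.cons_tuple (a, tset t i s).
Proof.
apply: eq_from_tnth => j; rewrite tnth_mktuple.
case: (unliftP ord0 j) => [k|] -> //=.
by rewrite !tnthS (inj_eq lift_inj) tnth_mktuple.
Qed.

(** Adding M makes the integrand nonnegative: then Tonelli's theorem needs no
    integrability and splits the integral over the cube variable by variable. *)
Lemma unif_derive (F G : R -> R) (M : R) :
  (forall s : R, is_derive s (1 : R) F (G s)) -> continuous G -> F 0 = F 1 ->
  (forall s, `|G s| <= M) ->
  (\int[unif]_s (G s + M)%:E = M%:E)%E.
Proof.
move=> dF cG F01 GM.
have cF : continuous F.
  by move=> x; apply: differentiable_continuous; apply/derivable1_diffP; have [] := dF x.
have mGM : measurable_fun (setT : set mR) (fun s : mR => (G s + M : R)).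
  by apply: continuous_measurable_fun => x; apply: cvgD; [exact: cG|exact: cvg_cst].
rewrite integral_uniform; first last.
- by move=> x; rewrite lee_fin -lerBlDr sub0r; have := GM x; rewrite ler_norml => /andP[].
- exact/measurable_EFinP.
rewrite subr0 invr1 mul1e.
rewrite (@continuous_FTC2 _ (fun s => G s + M) (fun s => F s + s * M))//.
- by rewrite F01 mul1r mul0r addr0 -EFinB addrAC subrr add0r.
- apply: continuous_subspaceT => x.
  by apply: cvgD; [exact: cG|exact: cvg_cst].
- have cFM : continuous (fun s => F s + s * M).
    move=> x; apply: cvgD; first exact: cF.
    by apply: cvgM; [exact: cvg_id|exact: cvg_cst].
  split.
  + move=> x _; have dFx := dF x; exact: ex_derive.
  + by apply: cvg_at_right_filter; exact: cFM.
  + by apply: cvg_at_left_filter; exact: cFM.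
- move=> x _; have dFx := dF x; rewrite derive1E derive_val.
  by rewrite /GRing.scale/= mulr1 mulr0 add0r.
Qed.

(** Integrate first in the i-th variable, where the fundamental theorem of
    calculus applies. *)
Lemma cube_derive n (i : 'I_n) (F G : n.-tuple mR -> R) (M : R) :
  measurable_fun setT G -> (forall t, `|G t| <= M) ->
  (forall t, continuous (fun s : R => G (tset t i s))) ->
  (forall t (s : R), is_derive s (1 : R) (fun s : R => F (tset t i s)) (G (tset t i s))) ->
  (forall t, F (tset t i 0) = F (tset t i 1)) ->
  (\int[cube_prob R n]_t (G t + M)%:E = M%:E)%E.
Proof.
elim: n i F G => [[]//|n IH] i F G mG GM cG dF F01.
have GM0 t : (0 <= (G t + M)%:E)%E.
  by rewrite lee_fin -lerBlDr sub0r; have := GM t; rewrite ler_norml => /andP[].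
have mGM : measurable_fun setT (fun t => (G t + M)%:E).
  apply/measurable_EFinP; exact: measurable_funD.
have [E1 E2] := integral_cubeS mGM GM0.
case: (unliftP ord0 i) => [j|] ij; subst i.
  rewrite E1 (eq_integral (cst M%:E)); last first.
    move=> a _; apply: (IH j (fun t => F (Defs.cons_tuple (a, t)))
      (fun t => G (Defs.cons_tuple (a, t)))) => //.
    - apply: (measurableT_comp mG); apply: (measurableT_comp (@measurable_cons_tuple R n)).
      exact: measurable_pair1.
    - by move=> t; have := cG (Defs.cons_tuple (a, t)); under eq_fun do rewrite tset_consS.
    - move=> t s; have := dF (Defs.cons_tuple (a, t)) s.
      by under eq_fun do rewrite tset_consS; rewrite tset_consS.
    - by move=> t; have := F01 (Defs.cons_tuple (a, t)); rewrite !tset_consS.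
  exact: integral_prob_cst.
rewrite E2 (eq_integral (cst M%:E)); last first.
  move=> t _; apply: (@unif_derive (fun a => F (Defs.cons_tuple (a, t)))
    (fun t' => G (Defs.cons_tuple (t', t)))) => //.
  - move=> s; have := dF (Defs.cons_tuple (0, t)) s.
    by under eq_fun do rewrite tset_cons0; rewrite tset_cons0.
  - by have := cG (Defs.cons_tuple (0, t)); under eq_fun do rewrite tset_cons0.
  - by have := F01 (Defs.cons_tuple (0, t)); rewrite !tset_cons0.
exact: integral_prob_cst.
Qed.

Lemma unif_ball_gt0 (c e : R) : 0 <= c <= 1 -> 0 < e ->
  (0 < unif [set x | `|x - c| < e]%R)%E.
Proof.
move=> /andP[c0 c1] e0.
pose l := Num.max 0 (c - e); pose r := Num.min 1 (c + e).
have lr : l < r.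
  by rewrite lt_min !gt_max ltr01/= ltrBlDr (le_lt_trans c1) ?ltrDl//=
    (le_lt_trans c0) ?ltrDl//= ltrBlDr -addrA ltrDl addr_gt0.
have mU : measurable ([set` `]l, r[] : set mR) by [].
have sub : [set` `]l, r[] `<=` [set x | `|x - c| < e].
  move=> x /=; rewrite in_itv/= gt_max lt_min => /andP[/andP[_ h1] /andP[_ h2]].
  by rewrite ltr_distl h1.
have mB : measurable ([set x | `|x - c| < e]%R : set mR).
  have -> : [set x | `|x - c| < e] = [set` `]c - e, c + e[].
    by apply/seteqP; split => x /=; rewrite in_itv/= ltr_distl.
  by [].
apply: (@lt_le_trans _ _ (unif [set` `]l, r[])); last by apply: le_measure; rewrite ?inE.
have := integral_indic unif measurableT mU; rewrite setIT => <-.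
rewrite integral_uniform//; last first.
  by apply/measurable_EFinP; exact: measurable_indic.
rewrite subr0 invr1 mul1e integral_indic// setIidl; last first.
  move=> x /=; rewrite !in_itv/= gt_max lt_min => /andP[/andP[h1 _] /andP[h2 _]].
  by rewrite !ltW.
suff : (0 < lebesgue_measure [set` `]l, r[%R])%E by [].
by rewrite lebesgue_measure_itv/= lte_fin lr -EFinB lte_fin subr_gt0.
Qed.

(** The centre may lie on the boundary of the cube, where only part of the box
    counts. Together with continuity this makes Lebesgue measure detect every nonempty
    open subset of the torus. *)
Lemma cube_box_gt0 n (c : 'I_n -> R) (e : R) :
  (forall i, 0 <= c i <= 1) -> 0 < e ->
  measurable [set t : n.-tuple mR | forall i, `|(tnth t i : R) - c i| < e] /\
  (0 < cube_prob R n [set t | forall i, `|(tnth t i : R) - c i| < e]%R)%E.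
Proof.
move=> c01 e0.
have mb m (c' : 'I_m -> R) :
    measurable [set t : m.-tuple mR | forall i, `|(tnth t i : R) - c' i| < e].
  rewrite (_ : [set _ | _] = \bigcap_(i in [set: 'I_m])
    [set x | `|(tnth x i : R) - c' i| < e]); last first.
    by apply/seteqP; split => x /= h i; [move=> _|]; exact: h.
  apply: fin_bigcap_measurable => // i _.
  have := @measurable_tnth _ mR m i measurableT
    [set` `]c' i - e, c' i + e[] (measurable_itv _).
  rewrite setTI; congr (measurable _); apply/seteqP.
  by split => x /=; rewrite in_itv/= ltr_distl.
split; first exact: mb.
elim: n c c01 => [|n IH] c c01.
  rewrite (_ : [set _ | _] = setT) ?probability_setT//.
  by apply/seteqP; split => // t _ [].
have E : [set x : mR | `|(x : R) - c ord0| < e] `*`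
   [set t : n.-tuple mR | forall i, `|(tnth t i : R) - c (lift ord0 i)| < e] =
   @Defs.cons_tuple R n @^-1` [set t | forall i, `|(tnth t i : R) - c i| < e].
  apply/seteqP; split => -[a t] /=.
    move=> [h0 h] i; case: (unliftP ord0 i) => [j|] -> //=.
    by rewrite tnthS.
  move=> h; split; first exact: (h ord0).
  by move=> i; have := h (lift ord0 i); rewrite tnthS.
change (0 < (unif \x cube_prob R n) (@Defs.cons_tuple R n @^-1`
   [set t | forall i, (`|(tnth t i : R) - c i| < e)%R]))%E.
rewrite -E product_measure1E//.
    by apply: mule_gt0; [exact: unif_ball_gt0|exact: IH].
  2: exact: mb.
have -> : [set x : mR | `|(x : R) - c ord0| < e] = [set` `]c ord0 - e, c ord0 + e[].
  by apply/seteqP; split => x /=; rewrite in_itv/= ltr_distl.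
by [].
Qed.

End Cube.

(** * Integration on the torus *)

Lemma continuous_bounded_on (R : realType) (X : topologicalType) (h : X -> R)
    (K : set X) : {within K, continuous h} -> compact K ->
  exists2 M : R, 0 < M & forall x, K x -> `|h x| <= M.
Proof.
move=> ch cK; have := continuous_compact ch cK.
move=> /compact_bounded[M [_ hM]].
exists (`|M| + 1); first by rewrite ltr_pwDr.
move=> x Kx; apply: (hM (`|M| + 1)); last by exists x.
by rewrite (le_lt_trans (ler_norm M))// ltrDl.
Qed.

Lemma cvg_sumr (R : realType) (U : Type) (F : set_system U) {FF : Filter F}
    (n : nat) (h : 'I_n -> U -> R) (l : 'I_n -> R) :
  (forall i, h i x @[x --> F] --> l i) ->
  (\sum_i h i x) @[x --> F] --> \sum_i l i.
Proof. by move=> hl; apply: cvg_big => //; exact: add_continuous. Qed.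

Lemma continuous_sumr (R : realType) (T : topologicalType) (n : nat)
    (h : 'I_n -> T -> R) :
  (forall i, continuous (h i)) -> continuous (fun x => \sum_i h i x).
Proof. by move=> ch x; apply: cvg_sumr => i; exact: ch. Qed.

Section RealContinuity.
Variables (R : realType) (T : topologicalType).
Implicit Types h k : T -> R.

Lemma contD h k : continuous h -> continuous k -> continuous (fun x => h x + k x).
Proof. by move=> ch ck x; apply: cvgD; [exact: ch|exact: ck]. Qed.

Lemma contB h k : continuous h -> continuous k -> continuous (fun x => h x - k x).
Proof. by move=> ch ck x; apply: cvgB; [exact: ch|exact: ck]. Qed.

Lemma contM h k : continuous h -> continuous k -> continuous (fun x => h x * k x).
Proof. by move=> ch ck x; apply: cvgM; [exact: ch|exact: ck]. Qed.

Lemma contC (r : R) : continuous (fun _ : T => r).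
Proof. by move=> x; exact: cvg_cst. Qed.

Lemma contZ (r : R) h : continuous h -> continuous (fun x => r * h x).
Proof. by move=> ch; apply: contM => //; exact: contC. Qed.

Lemma contN h : continuous h -> continuous (fun x => - h x).
Proof. by move=> ch x; apply: cvgN; exact: ch. Qed.

Lemma cont_norm h : continuous h -> continuous (fun x => `|h x|).
Proof. by move=> ch x; apply: cvg_norm; exact: ch. Qed.

End RealContinuity.

Section TorusIntegral.
Variables (R : realType) (d : nat).
Local Notation TT := (torus R d).
Local Notation ee i := (delta_mx ord0 i : 'rV[R]_d).
Local Notation lam := (torus_lebesgue R d).
Implicit Types (phi psi : TT -> R) (i : 'I_d).

Definition tint (phi : TT -> R) : R := \int[lam]_x phi x.

Lemma torus_measurable phi : continuous phi -> measurable_fun setT phi.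
Proof.
move=> cphi; apply: (measurability _ (RGenOpens.measurableE R)).
move=> _ [_ [a [b ->]] <-]; rewrite setTI.
apply: sub_sigma_algebra; move/continuousP: cphi; apply; exact: interval_open.
Qed.

Lemma torus_bounded phi : continuous phi ->
  exists2 M : R, 0 < M & forall x, `|phi x| <= M.
Proof.
move=> cphi.
have [M M0 hM] := continuous_bounded_on (continuous_subspaceT cphi) (@torus_compact R d).
by exists M => // x; exact: hM.
Qed.

Lemma torus_integrable phi : continuous phi -> lam.-integrable setT (EFin \o phi).
Proof.
move=> cphi; apply: measurable_bounded_integrable => //.
- by rewrite (@le_lt_trans _ _ 1%E) ?ltry// probability_le1.
- exact: torus_measurable.
- have [M _ hM] := torus_bounded cphi.
  exists M; split; first exact: num_real.
  by move=> y My x _ /=; rewrite (le_trans (hM x))// ltW.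
Qed.

Lemma tintD phi psi : continuous phi -> continuous psi ->
  tint (fun x => phi x + psi x) = tint phi + tint psi.
Proof. by move=> *; rewrite /tint RintegralD//; exact: torus_integrable. Qed.

Lemma tintB phi psi : continuous phi -> continuous psi ->
  tint (fun x => phi x - psi x) = tint phi - tint psi.
Proof. by move=> *; rewrite /tint RintegralB//; exact: torus_integrable. Qed.

Lemma tintZ (r : R) phi : continuous phi ->
  tint (fun x => r * phi x) = r * tint phi.
Proof. by move=> *; rewrite /tint RintegralZl//; exact: torus_integrable. Qed.

Lemma tint_cst (r : R) : tint (fun=> r) = r.
Proof.
rewrite /tint Rintegral_cst//.
have -> : (lam : {measure set TT -> \bar R}) setT = 1%E by exact: probability_setT.
by rewrite mulr1.
Qed.

Lemma tint_sum (n : nat) (phi : 'I_n -> TT -> R) :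
  (forall j, continuous (phi j)) ->
  tint (fun x => \sum_j phi j x) = \sum_j tint (phi j).
Proof.
elim: n phi => [phi _|n IH phi cphi].
  by under eq_fun do rewrite big_ord0; rewrite big_ord0 tint_cst.
under eq_fun do rewrite big_ord_recl; rewrite big_ord_recl tintD//.
  by rewrite IH.
by apply: continuous_sumr.
Qed.

Lemma tint_ge0 phi : (forall x, 0 <= phi x) -> 0 <= tint phi.
Proof. by move=> h; apply: Rintegral_ge0. Qed.

Lemma tint_le phi psi : continuous phi -> continuous psi ->
  (forall x, phi x <= psi x) -> tint phi <= tint psi.
Proof.
move=> cphi cpsi le; apply: le_Rintegral => //; exact: torus_integrable.
Qed.

Lemma tint_norm_le phi : continuous phi -> `|tint phi| <= tint (fun x => `|phi x|).
Proof. by move=> cphi; apply: le_normr_Rintegral => //; exact: torus_integrable. Qed.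

Lemma tint_bound phi M : continuous phi -> (forall x, `|phi x| <= M) ->
  `|tint phi| <= M.
Proof.
move=> cphi hM; rewrite (le_trans (tint_norm_le cphi))// -[leRHS]tint_cst.
by apply: tint_le => //; [exact: cont_norm|exact: contC].
Qed.

(** If phi is positive at a point then it exceeds half of that value on a box
    around a representative in the unit cube, and boxes have positive measure. *)
Lemma tint_eq0 phi : continuous phi -> (forall x, 0 <= phi x) -> tint phi = 0 ->
  forall x, phi x = 0.
Proof.
move=> cphi phi0 int0 x; apply/eqP; rewrite eq_le phi0 andbT leNgt.
apply/negP => phix.
have [c cx c01] := tproj_unit_cube x.
have := (iffLR (continuous_torusP phi)) cphi c.
move=> /cvgrPdist_lt/(_ (phi x / 2)) /(_ (divr_gt0 phix (ltr0Sn _ 1))).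
move=> /nbhs_ballP[e /= e0 he].
have [mB B0] := @cube_box_gt0 R d (fun i => c ord0 i) e c01 e0.
set B := [set t | _] in mB B0.
have m2 : measurable_fun setT
    (fun t : d.-tuple (measurableTypeR R) => (phi (tuple_torus t))%:E).
  apply/measurable_EFinP; apply: (measurableT_comp (torus_measurable cphi)).
  exact: measurable_tuple_torus.
have : (\int[lam]_x (phi x)%:E = 0)%E.
  have /fineK <- := integrable_fin_num measurableT (torus_integrable cphi).
  by rewrite -[X in _ = X]/(0%:E) -int0.
rewrite /torus_lebesgue ge0_integral_distribution//; last first.
  by apply/measurable_EFinP; exact: torus_measurable.
move=> int0'.
have : ((phi x / 2)%:E * cube_prob R d B <= 0)%E.
  rewrite -int0' -integral_cst//.
  apply: (@le_trans _ _ (\int[cube_prob R d]_(t in B) (phi (tuple_torus t))%:E)%E).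
    apply: ge0_le_integral => //.
    - by move=> t _; rewrite lee_fin divr_ge0// ltW.
    - exact: measurable_funTS.
    - move=> t Bt; rewrite lee_fin.
      have /= := he (\row_i (tnth t i : R)).
      rewrite cx -/(tuple_torus t) => hh.
      have /hh : ball c e (\row_i (tnth t i : R)).
        rewrite -ball_normE /ball_/= /Num.Def.normr/= mx_normrE.
        apply/bigmax_ltP; split => //= -[i j] _; rewrite ord1 !mxE distrC.
        exact: Bt.
      by rewrite ltr_distl => /andP[_]; lra.
  apply: ge0_subset_integral => //.
  by move=> t _; rewrite lee_fin.
apply/negP; rewrite -ltNge mule_gt0// lte_fin divr_gt0//.
Qed.

Lemma tuple_torus_tset (t : d.-tuple (measurableTypeR R)) i (s : R) :
  tuple_torus (tset t i s) =
  tproj ((\row_j (tnth (tset t i 0) j : R)) + s *: ee i).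
Proof.
congr tproj; apply/rowP => j; rewrite !mxE !tnth_mktuple eqxx/=.
by case: ifP; rewrite ?mulr1 ?add0r ?mulr0 ?addr0.
Qed.

(** The lift takes equal values at both ends of each coordinate segment of the
    unit cube. *)
Lemma tint_tpartial phi i : (forall x, tderivable i phi x) ->
  continuous (tpartial i phi) -> tint (tpartial i phi) = 0.
Proof.
move=> dphi cG; have [M M0 hM] := torus_bounded cG.
have mG := torus_measurable cG.
have GM : (\int[lam]_x (tpartial i phi x + M)%:E = M%:E)%E.
  rewrite /torus_lebesgue ge0_integral_distribution//; last 2 first.
  - by apply/measurable_EFinP; exact: measurable_funD.
  - move=> y; rewrite lee_fin -lerBlDr sub0r.
    by have := hM y; rewrite ler_norml => /andP[].
  apply: (@cube_derive R d i (fun t => phi (tuple_torus t))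
    (fun t => tpartial i phi (tuple_torus t)) M).
  - apply: (measurableT_comp mG); exact: measurable_tuple_torus.
  - by move=> t; exact: hM.
  - move=> t; under eq_fun do rewrite tuple_torus_tset.
    have cl : continuous (fun s : R => (\row_j (tnth (tset t i 0) j : R)) + s *: ee i).
      move=> s; apply: cvgD; first exact: cvg_cst.
      by apply: cvgZl; exact: cvg_id.
    have cG' := iffLR (continuous_torusP _) cG.
    by move=> s; exact: (@continuous_comp _ _ _
      (fun s : R => (\row_j (tnth (tset t i 0) j : R)) + s *: ee i)
      (tpartial i phi \o @tproj R d) s (cl s) (cG' _)).
  - move=> t s; under eq_fun do rewrite tuple_torus_tset.
    rewrite tuple_torus_tset.
    apply: (iffLR (is_derive_line (phi \o @tproj R d) _ (ee i) s _)).
    exact: is_derive_lift.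
  - move=> t; congr phi; rewrite !tuple_torus_tset; apply/tproj_eqP => j.
    rewrite !mxE !eqxx/= opprD addrACA subrr add0r mul0r sub0r rpredN mul1r.
    by case: (j == i); rewrite ?rpred0 ?rpred1.
have : tint (fun x => tpartial i phi x + M) = M by rewrite /tint /Rintegral GM.
rewrite tintD//; last exact: contC.
by rewrite tint_cst -[X in _ = X]add0r => /addIr.
Qed.

Lemma tpartialM phi psi i x : tderivable i phi x -> tderivable i psi x ->
  tderivable i (fun y => phi y * psi y) x /\
  tpartial i (fun y => phi y * psi y) x =
    phi x * tpartial i psi x + psi x * tpartial i phi x.
Proof.
move=> /is_derive_repr dphi /is_derive_repr dpsi; apply: tderivable_repr.
have := is_deriveM dphi dpsi; rewrite /GRing.scale/= !tprojK.
by [].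
Qed.

Lemma tint_by_parts phi psi i : continuous phi -> continuous psi ->
  (forall x, tderivable i phi x) -> (forall x, tderivable i psi x) ->
  continuous (tpartial i phi) -> continuous (tpartial i psi) ->
  tint (fun x => phi x * tpartial i psi x) =
  - tint (fun x => psi x * tpartial i phi x).
Proof.
move=> cphi cpsi dphi dpsi cdphi cdpsi.
have E : tpartial i (fun y => phi y * psi y) =
    (fun x => phi x * tpartial i psi x + psi x * tpartial i phi x).
  by apply/funext => x; have [_ ->] := tpartialM (dphi x) (dpsi x).
have c1 : continuous (fun x => phi x * tpartial i psi x).
  exact: contM.
have c2 : continuous (fun x => psi x * tpartial i phi x).
  exact: contM.
apply/eqP; rewrite -addr_eq0 -tintD// -E; apply/eqP; apply: tint_tpartial.
  by move=> x; have [] := tpartialM (dphi x) (dpsi x).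
by rewrite E; exact: contD.
Qed.

Lemma tint_by_parts2 phi psi i : continuous phi ->
  (forall x, tderivable i phi x) -> continuous (tpartial i phi) ->
  continuous (tpartial i psi) ->
  (forall x, tderivable i (tpartial i psi) x) ->
  continuous (tpartial i (tpartial i psi)) ->
  tint (fun x => phi x * tpartial i (tpartial i psi) x) =
  - tint (fun x => tpartial i phi x * tpartial i psi x).
Proof.
move=> cphi dphi cdphi cdpsi ddpsi cddpsi.
rewrite (@tint_by_parts phi (tpartial i psi) i cphi cdpsi dphi ddpsi cdphi cddpsi).
by congr (- tint _); apply/funext => x; rewrite mulrC.
Qed.

End TorusIntegral.

#[global] Opaque tint.

(** * Continuity and differentiation in time *)

Section ParametricContinuity.
Variables (R : realType) (U : topologicalType).
Implicit Types (I : set R) (w : R -> U -> R).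

(** The condition of continuous_TX over an arbitrary space of positions; on the
    torus the two are convertible. *)
Definition jcontinuous I w :=
  {within I `*` [set: U], continuous (fun z : R * U => w z.1 z.2)}.

Lemma jcontinuousP I w : jcontinuous I w <-> forall t x, I t ->
    (w z.1 z.2) @[z --> within (I `*` [set: U]) (nbhs (t, x))] --> w t x.
Proof.
rewrite /jcontinuous subspace_continuousP; split.
  by move=> h t x It; apply: (h (t, x)).
by move=> h [t x] /= [It _]; exact: h.
Qed.

Lemma jcontinuous_near I w t x : jcontinuous I w -> I t ->
  forall e, 0 < e -> exists A B, [/\ nbhs t A, nbhs x B &
    forall s z, A s -> I s -> B z -> `|w s z - w t x| < e].
Proof.
move=> /jcontinuousP/(_ t x)/[apply] /cvgrPdist_lt h e e0.
have [[A B] /= [nA nB] AB] := h e e0.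
exists A, B; split => // s z As Is Bz.
by rewrite distrC; apply: (AB (s, z)).
Qed.

Lemma jcontinuous_slice I w t : jcontinuous I w -> I t -> continuous (w t).
Proof.
move=> cw It x; apply/cvgrPdist_lt => e e0.
have [A [B [nA nB AB]]] := jcontinuous_near x cw It e0.
apply: filterS nB => z Bz; rewrite distrC; apply: AB => //.
exact: nbhs_singleton.
Qed.

(** Compactness of the space of positions makes continuity in time uniform. *)
Lemma jcontinuous_unif I w t : compact [set: U] -> jcontinuous I w -> I t ->
  forall e, 0 < e -> \forall s \near within I (nbhs t),
    forall x, `|w s x - w t x| < e.
Proof.
move=> cU cw It e e0.
have h : \forall s \near within I (nbhs t), [set: U] `<=` (fun x => `|w s x - w t x| < e).
  apply: (iffLR (compact_near_coveringP _) cU) => x _.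
  have e20 : 0 < e / 2 by rewrite divr_gt0.
  have [A [B [nA nB AB]]] := jcontinuous_near x cw It e20.
  exists (B, A `&` I) => /=.
    by split => //; rewrite /within/=; apply: filterS nA => s As Is; split.
  move=> [z s]/= [Bz [As Is]].
  rewrite (splitr e) -(subrKA (w t x)) (le_lt_trans (ler_normD _ _))//.
  rewrite ltrD//; first exact: AB.
  by rewrite distrC; apply: AB => //; exact: nbhs_singleton.
by apply: filterS h => s hs x; exact: hs.
Qed.

End ParametricContinuity.

Section TimeDependent.
Variables (R : realType) (d : nat).
Local Notation TT := (torus R d).
Implicit Types (I : set R) (w y : R -> TT -> R).

Lemma tint_continuous I w : jcontinuous I w ->
  {within I, continuous (fun t => tint (w t))}.
Proof.
move=> cw; apply/subspace_continuousP => t It; apply/cvgrPdist_lt => e e0.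
have e20 : 0 < e / 2 by rewrite divr_gt0.
have := jcontinuous_unif (@torus_compact R d) cw It e20; rewrite !near_withinE.
apply: filterS => s hs Is.
have cs := jcontinuous_slice cw Is; have ct := jcontinuous_slice cw It.
rewrite -tintB//; apply: (@le_lt_trans _ _ (e / 2)); last by lra.
apply: tint_bound; first exact: contB.
by move=> x; rewrite distrC ltW// hs.
Qed.

(** Phi s is meant to be a quadratic form <w s, S (w s)> with S symmetric, and
    y = S w: then Phi s - Phi t = <w s - w t, S (w s + w t)>. No time derivative of
    y is involved, so that S may be a second order operator in space. *)
Lemma tint_is_derive I w w' y (Phi : R -> R) (t : R) :
  nbhs t I -> jcontinuous I w' -> jcontinuous I y ->
  (forall s, I s -> continuous (w s)) ->
  (forall s x, I s -> is_derive s (1 : R) (w ^~ x) (w' s x)) ->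
  (forall s, I s ->
     Phi s - Phi t = tint (fun x => (w s x - w t x) * (y s x + y t x))) ->
  is_derive t (1 : R) Phi (2 * tint (fun x => w' t x * y t x)).
Proof.
move=> nI cw' cy cw dw dPhi; have It := nbhs_singleton nI.
have cyt := jcontinuous_slice cy It; have cwt' := jcontinuous_slice cw' It.
suff L : (fun h : R => h^-1 *: ((Phi \o shift t) (h *: (1 : R)) - Phi t)) @ 0^' -->
    (2 * tint (fun x => w' t x * y t x)).
  by split; [apply/cvg_ex; eexists; exact: L|exact: cvg_lim L].
apply/cvgrPdist_lt => e e0.
have [M M0 hM] := torus_bounded cyt; have [N N0 hN] := torus_bounded cwt'.
(* Increments of w' and y below eta move the integrand by at most eta * K. *)
pose K := 2 * M + N + 1.
have K0 : 0 < K by rewrite /K !addr_gt0// mulr_gt0.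
pose eta := Num.min 1 (e / (2 * K)).
have eta0 : 0 < eta by rewrite lt_min ltr01 divr_gt0// mulr_gt0.
have eta1 : eta <= 1 by rewrite ge_min lexx.
have etaK : eta * K <= e / 2.
  have : eta <= e / (2 * K) by rewrite ge_min lexx orbT.
  by rewrite -(ler_pM2r K0) => /le_trans; apply; rewrite invfM mulrA divfK ?gt_eqF.
have n1 : \forall s \near t, [/\ I s, forall x, `|w' s x - w' t x| < eta &
    forall x, `|y s x - y t x| < eta].
  have := jcontinuous_unif (@torus_compact R d) cw' It eta0.
  have := jcontinuous_unif (@torus_compact R d) cy It eta0.
  rewrite !near_withinE => h1 h2.
  apply: filterS3 nI h1 h2 => s Is h1 h2.
  by split; [|exact: h2|exact: h1].
have [r /= r0 hr] := iffLR (nbhs_ballP _ _) n1.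
have near0 : \forall h \near (0 : R)^', h != 0 /\ `|h| < r.
  near=> h; split; first by near: h; exact: nbhs_dnbhs_neq.
  by near: h; exact: dnbhs0_lt.
apply: filterS near0 => h [h0 hlt].
pose s := t + h.
have hball (c : R) : 0 <= c <= 1 -> ball t r (t + c * h).
  move=> /andP[c0 c1]; rewrite -ball_normE /ball_/= opprD addrA subrr sub0r normrN.
  by rewrite normrM ger0_norm// (le_lt_trans _ hlt)// ler_piMl.
have hs : ball t r s by have := hball 1; rewrite mul1r; apply; rewrite ler01 lexx.
have [Is _ ys] := hr _ hs.
(* The difference quotient is a value of w' at a nearby time that depends on
   x; uniformity in x makes this harmless. *)
have mv x : exists2 xi, ball t r xi & w s x - w t x = w' xi x * h.
  have dg (c : R) : 0 <= c <= 1 ->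
      is_derive c (1 : R) (fun r : R => w (t + r * h) x) (w' (t + c * h) x * h).
    move=> c01; have [Ic _ _] := hr _ (hball c c01).
    have dl : is_derive c (1 : R) (fun r : R => t + r * h) h.
      by apply: is_derive_eq; rewrite /GRing.scale/=; ring.
    exact: (@is_derive1_comp _ (w ^~ x) (fun r : R => t + r * h) c _ _ (dw _ x Ic) dl).
  have dg1 (c : R) : c \in `]0, 1[%R ->
      is_derive c (1 : R) (fun r : R => w (t + r * h) x) (w' (t + c * h) x * h).
    by rewrite in_itv/= => /andP[/ltW c0 /ltW c1]; apply: dg; rewrite c0.
  have [|c] := MVT_segment (@ler01 R) dg1.
    apply: derivable_within_continuous => c; rewrite in_itv/= => c01.
    by have [] := dg c c01.
  rewrite in_itv/= mul1r mul0r addr0 subr0 mulr1 => c01 ->.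
  by exists (t + c * h) => //; exact: hball.
have cws := cw s Is; have cwt := cw t It.
have cys := jcontinuous_slice cy Is.
rewrite /= /GRing.scale/= mulr1 [h + t]addrC -/s dPhi//.
have cq : continuous (fun x => (w s x - w t x) * (y s x + y t x)).
  by apply: contM; [exact: contB|exact: contD].
rewrite -!tintZ -?tintB//; first last.
- exact: contM.
- exact: contZ.
- by apply: contZ; exact: contM.
apply: (@le_lt_trans _ _ (e / 2)); last by lra.
apply: tint_bound; first by apply: contB; apply: contZ => //; exact: contM.
move=> x; have [xi bxi ->] := mv x.
have [_ w'xi _] := hr _ bxi.
have -> : h^-1 * (w' xi x * h * (y s x + y t x)) = w' xi x * (y s x + y t x).
  by field.
have -> : 2 * (w' t x * y t x) - w' xi x * (y s x + y t x) =
  - (2 * y t x * (w' xi x - w' t x)) -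
  (w' t x + (w' xi x - w' t x)) * (y s x - y t x) by ring.
apply: le_trans etaK.
have d1 := ltW (w'xi x); have d2 := ltW (ys x).
apply: (le_trans (ler_normB _ _)); rewrite normrN !normrM ger0_norm//.
have : `|w' t x + (w' xi x - w' t x)| <= N + eta.
  by rewrite (le_trans (ler_normD _ _))// lerD.
have := hM x; move: d1 d2.
move: `|y t x| `|w' xi x - w' t x| `|y s x - y t x| `|w' t x + _|
  (normr_ge0 (y t x)) (normr_ge0 (w' xi x - w' t x)) (normr_ge0 (y s x - y t x))
  (normr_ge0 (w' t x + (w' xi x - w' t x))) => a b c f a0 b0 c0 f0 b1 c1 a1 f1.
have h1 : 2 * a * b <= 2 * M * eta by rewrite ler_pM// ?mulr_ge0// ler_wpM2l.
have h2 : f * c <= (N + 1) * eta.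
  by rewrite ler_pM// (le_trans f1)// lerD2l.
by rewrite /K; apply: (le_trans (lerD h1 h2)); lra.
Unshelve. all: by end_near.
Qed.

End TimeDependent.

(** * Functions of class C^1 in position and momentum *)

Lemma cvg_rV (R : realType) n (T : Type) (F : set_system T) {FF : Filter F}
    (h : T -> 'rV[R]_n) (l : 'rV[R]_n) :
  (forall j, h x ord0 j @[x --> F] --> l ord0 j) -> h x @[x --> F] --> l.
Proof.
move=> hl; apply/cvgrPdist_lt => e e0.
have : \forall x \near F, forall j, `|l ord0 j - h x ord0 j| < e.
  apply: filter_forall => j; have /cvgrPdist_lt := hl j; exact.
apply: filterS => x hx; rewrite /Num.Def.normr/= mx_normrE.
apply/bigmax_ltP; split => // -[i j] _ /=; rewrite ord1 !mxE.
exact: hx.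
Qed.

Lemma is_derive_cvg (R : realType) (V W : normedModType R) (h : V -> W) a v l :
  is_derive a v h l <->
  (fun s : R => s^-1 *: (h (s *: v + a) - h a)) @ 0^' --> l.
Proof.
split=> [[/cvg_ex[k hk] <-]|hl].
  by rewrite /derive (cvg_lim _ hk).
by split; [apply/cvg_ex; exists l; exact: hl|exact: cvg_lim hl].
Qed.

Section JointContinuity.
Variables (R : realType) (U : topologicalType) (I : set R).
Implicit Types (w y : R -> U -> R).

Lemma jcontB w y : jcontinuous I w -> jcontinuous I y ->
  jcontinuous I (fun t x => w t x - y t x).
Proof.
move=> /jcontinuousP cw /jcontinuousP cy; apply/jcontinuousP => t x It.
by apply: cvgB; [exact: cw|exact: cy].
Qed.

Lemma jcontM w y : jcontinuous I w -> jcontinuous I y ->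
  jcontinuous I (fun t x => w t x * y t x).
Proof.
move=> /jcontinuousP cw /jcontinuousP cy; apply/jcontinuousP => t x It.
by apply: cvgM; [exact: cw|exact: cy].
Qed.

Lemma jcontC (r : R) : jcontinuous I (fun _ (_ : U) => r).
Proof. by apply/jcontinuousP => t x It; exact: cvg_cst. Qed.

Lemma jcontN w : jcontinuous I w -> jcontinuous I (fun t x => - w t x).
Proof.
by move=> /jcontinuousP cw; apply/jcontinuousP => t x It; apply: cvgN; exact: cw.
Qed.

Lemma jcont_sum n (w : 'I_n -> R -> U -> R) :
  (forall j, jcontinuous I (w j)) ->
  jcontinuous I (fun t x => \sum_j w j t x).
Proof.
move=> cw; apply/jcontinuousP => t x It; apply: cvg_sumr => j.
by have /jcontinuousP := cw j; exact.
Qed.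

Lemma jcontS (J : set R) w : J `<=` I -> jcontinuous I w -> jcontinuous J w.
Proof.
move=> JI; apply: continuous_subspaceW => -[t x] [/= Jt _]; split => //.
exact: JI.
Qed.

Lemma jcont_bounded w : compact [set: U] -> compact I -> jcontinuous I w ->
  exists2 M : R, 0 < M & forall t x, I t -> `|w t x| <= M.
Proof.
move=> cU cI cw.
have [M M0 hM] := continuous_bounded_on cw (compact_setX cI cU).
by exists M => // t x It; apply: (hM (t, x)).
Qed.

End JointContinuity.

Section ClassC1.
Variables (R : realType) (d : nat).
Local Notation TT := (torus R d).
Local Notation ee i := (delta_mx ord0 i : 'rV[R]_d).
Variable F : TT -> 'rV[R]_d -> R.
Hypothesis C1F : class_C1 F.

Let dFp j x p : is_derive p (ee j) (F x) ('D_(ee j) (F x) p).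
Proof. by have [_ /(_ j)[_ h _ _]] := C1F; apply: derivableP. Qed.

Lemma C1_bounded (h : TT -> 'rV[R]_d -> R) (M : R) :
  continuous (fun z : TT * 'rV[R]_d => h z.1 z.2) ->
  exists2 L : R, 0 < L &
    forall x (p : 'rV[R]_d), (forall j, `|p ord0 j| <= M) -> `|h x p| <= L.
Proof.
move=> ch.
have cK : compact [set p : 'rV[R]_d | forall j, p ord0 j \in `[- M, M]].
  have := @rV_compact _ d (fun=> `[- M, M]%classic).
  by move/(_ (fun=> @segment_compact _ _ _)).
have [L L0 hL] := continuous_bounded_on (continuous_subspaceT ch)
  (compact_setX (@torus_compact R d) cK).
exists L => // x p hp; apply: (hL (x, p)); split => //= j.
by rewrite in_itv/= -ler_norml.
Qed.

(** The intermediate points of mvt_telescope between two points of the box of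
    size M stay in the box of size 3 * M, on which partial derivatives are bounded. *)
Lemma C1_lipschitz (M : R) : exists2 L : R, 0 < L & forall x (p q : 'rV[R]_d),
  (forall j, `|p ord0 j| <= M) -> (forall j, `|q ord0 j| <= M) ->
  `|F x p - F x q| <= L * \sum_j `|p ord0 j - q ord0 j|.
Proof.
have /choice[L hL] : forall j, exists L : R, 0 < L /\
    forall x (p : 'rV[R]_d), (forall j, `|p ord0 j| <= 3 * M) -> `|'D_(ee j) (F x) p| <= L.
  move=> j; have [_ /(_ j)[_ _ _ cD]] := C1F.
  by have [L L0 hL] := C1_bounded (h := fun x p => 'D_(ee j) (F x) p) (3 * M) cD; exists L.
exists (\sum_j L j + 1).
  by rewrite ltr_wpDl// sumr_ge0// => j _; have [/ltW] := hL j.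
move=> x p q hp hq.
have [xi [hxi ->]] := mvt_telescope (fun j y => dFp j x y) q p.
rewrite (le_trans (ler_norm_sum _ _ _))// mulr_sumr ler_sum// => j _.
rewrite normrM mulrC ler_wpM2r//.
have [_ /(_ x (xi j)) hLj] := hL j.
apply: le_trans (hLj _) _.
  move=> k; have h1 := hxi j k; have h2 := hp k; have h3 := hq k.
  have -> : xi j ord0 k = (xi j ord0 k - q ord0 k) + q ord0 k by rewrite subrK.
  apply: le_trans (ler_normD _ _) _.
  have := ler_normB (p ord0 k) (q ord0 k); lra.
rewrite (bigD1 j)//= -addrA lerDl addr_ge0// sumr_ge0// => k _.
by have [/ltW] := hL k.
Qed.

(** The increment splits into a move of the position at fixed momentum and a
    telescoping of the momentum at fixed position. Joint continuity of the partial
    derivatives gives the limits at the intermediate points. *)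
Lemma C1_chain_rule (i : 'I_d) (p : TT -> 'rV[R]_d) (x : TT) :
  (forall j, tderivable i (fun y => p y ord0 j) x) ->
  tderivable i (fun y => F y (p y)) x /\
  tpartial i (fun y => F y (p y)) x =
    tpartial i (F ^~ (p x)) x +
    \sum_j 'D_(ee j) (F x) (p x) * tpartial i (fun y => p y ord0 j) x.
Proof.
move=> dp; apply: tderivable_repr.
set a := repr x; have ax : tproj a = x by exact: tprojK.
pose X (s : R) := tproj (a + s *: ee i) : TT.
have X0 : X 0 = x by rewrite /X scale0r addr0.
pose q j (s : R) := s^-1 * (p (X s) ord0 j - p x ord0 j).
have dq j : q j @ 0^' --> tpartial i (fun y => p y ord0 j) x.
  have /is_derive_cvg := is_derive_repr (dp j).
  rewrite -/a [X in X @ _ --> _](_ : _ = q j)//.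
  by apply/funext => s; rewrite /q /X /= ax [s *: _ + a]addrC.
have pq j s : p (X s) ord0 j = p x ord0 j + s * q j s.
  have [->|s0] := eqVneq s 0; first by rewrite mul0r addr0 X0.
  by rewrite /q mulrA divff// mul1r addrC subrK.
have id0 : (fun s : R => s) @ (0 : R)^' --> (0 : R).
  by apply: cvg_within_filter; exact: cvg_id.
have cP j : p (X s) ord0 j @[s --> (0 : R)^'] --> p x ord0 j.
  have -> : (fun s => p (X s) ord0 j) = (fun s => p x ord0 j + s * q j s).
    by apply/funext => s; exact: pq.
  have h : (fun s => p x ord0 j + s * q j s) @ (0 : R)^' -->
      p x ord0 j + 0 * tpartial i (fun y => p y ord0 j) x.
    by apply: cvgD; [exact: cvg_cst|exact: cvgM].
  by rewrite mul0r addr0 in h.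
have /choice[c hc] : forall s, exists c, 0 <= c <= 1 /\
    F (X s) (p (X s)) - F x (p (X s)) =
    s * tpartial i (F ^~ (p (X s))) (X (c * s)).
  move=> s; have [_ /(_ i)[dF _ _ _]] := C1F.
  have [c c01 h] := mvt_coord a s
    (fun y => is_derive_lift (dF (tproj y) (p (X s)))).
  by exists c; split => //; rewrite -h /= ax.
have /choice[xi hxi] : forall s, exists xi : 'I_d -> 'rV[R]_d,
    (forall j k, `|xi j ord0 k - p x ord0 k| <= `|p (X s) ord0 k - p x ord0 k|) /\
    F x (p (X s)) - F x (p x) =
    \sum_j (p (X s) ord0 j - p x ord0 j) * 'D_(ee j) (F x) (xi j).
  by move=> s; exact: (mvt_telescope (fun j y => dFp j x y)).
have cxi j : xi s j @[s --> (0 : R)^'] --> p x.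
  apply: cvg_rV => k; apply/cvgrPdist_le => e e0.
  have /cvgrPdist_le/(_ e e0) := cP k; apply: filterS => s hs.
  by rewrite distrC (le_trans _ hs)// [leRHS]distrC; have [/(_ j k)] := hxi s.
have cX : X (c s * s) @[s --> (0 : R)^'] --> x.
  rewrite -X0; apply: (@cvg_comp _ _ _ (fun s => c s * s) X _ (nbhs (0 : R))).
    apply/cvgrPdist_le => e e0.
    have /cvgrPdist_le/(_ e e0) := id0; apply: filterS => s.
    rewrite !sub0r !normrN normrM => hs; have [/andP[c0 c1] _] := hc s.
    by rewrite (le_trans _ hs)// ger0_norm// ler_piMl.
  have cl : continuous (fun s : R => a + s *: ee i).
    by move=> s; apply: cvgD; [exact: cvg_cst|apply: cvgZl; exact: cvg_id].
  have : {for 0, continuous (@tproj R d \o (fun s : R => a + s *: ee i))}.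
    by apply: continuous_comp; [exact: cl|exact: tproj_continuous].
  exact.
apply/is_derive_cvg; rewrite -/a.
have : (fun s => tpartial i (F ^~ (p (X s))) (X (c s * s)) +
    \sum_j 'D_(ee j) (F x) (xi s j) * q j s) @ (0 : R)^' -->
    tpartial i (F ^~ (p x)) x +
    \sum_j 'D_(ee j) (F x) (p x) * tpartial i (fun y => p y ord0 j) x.
  have [_ hF] := C1F; apply: cvgD.
    have [_ _ cF _] := hF i.
    apply: (@cvg_comp _ _ _ (fun s => (X (c s * s), p (X s)))
      (fun z : TT * 'rV[R]_d => tpartial i (F ^~ z.2) z.1) _
      (nbhs (x, p x)) _ _ (cF (x, p x))).
    have h2 : p (X s) @[s --> (0 : R)^'] --> p x by exact: cvg_rV.
    exact: cvg_pair cX h2.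
  apply: cvg_sumr => j; apply: cvgM; last exact: dq.
  have [_ _ _ cF] := hF j.
  apply: (@cvg_comp _ _ _ (fun s => (x, xi s j))
      (fun z : TT * 'rV[R]_d => 'D_(ee j) (F z.1) z.2) _
      (nbhs (x, p x)) _ _ (cF (x, p x))).
  have h1 : (fun _ : R => x) @ (0 : R)^' --> x by exact: cvg_cst.
  exact: cvg_pair h1 (cxi j).
apply: cvg_trans; apply: near_eq_cvg; near=> s.
have s0 : s != 0 by near: s; exact: nbhs_dnbhs_neq.
rewrite /= ax [s *: _ + a]addrC -/(X s) /GRing.scale/=.
have -> : F (X s) (p (X s)) - F x (p x) = (F (X s) (p (X s)) - F x (p (X s))) +
  (F x (p (X s)) - F x (p x)) by rewrite subrKA.
have [_ ->] := hc s; have [_ ->] := hxi s.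
rewrite mulrDr mulrA mulVf// mul1r; congr (_ + _).
rewrite mulr_sumr; apply: eq_bigr => j _.
by rewrite /q; ring.
Unshelve. all: by end_near.
Qed.

End ClassC1.

(** * The Monge--Kantorovich distance of two densities *)

Section Density.
Local Open Scope ereal_scope.
Context dT (T : measurableType dT) (R : realType).
Variables (lam mu : {measure set T -> \bar R}) (m : T -> R).
Hypothesis m_ge0 : forall x, (0 <= m x)%R.
Hypothesis m_meas : measurable_fun setT m.
Hypothesis mu_m : forall A, measurable A -> mu A = \int[lam]_(x in A) (m x)%:E.

Import HBNNSimple.

Let integral_density_nnsfun (h : {nnsfun T >-> R}) :
  \int[mu]_x (h x)%:E = \int[lam]_x ((h x)%:E * (m x)%:E).
Proof.
have mE : measurable_fun setT (EFin \o m) by exact/measurable_EFinP.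
transitivity (\int[mu]_x
   (\sum_(y \in range h) (y * \1_(h @^-1` [set y]) x)%:E)).
  by apply: eq_integral => t tE; rewrite /= fimfunE -fsumEFin.
have indich r : measurable_fun setT (fun x => (r * \1_(h @^-1` [set r]) x)%:E).
  by apply: (measurable_comp measurableT) => //; exact: measurable_funM.
rewrite ge0_integral_fsum//; last by move=> y x _; exact: nnfun_muleindic_ge0.
transitivity (\int[lam]_x (\sum_(y \in range h)
    (y * \1_(h @^-1` [set y]) x)%:E * (m x)%:E)); last first.
  apply: eq_integral => x xE.
  rewrite -ge0_mule_fsuml => [|y]; last exact: nnfun_muleindic_ge0.
  by rewrite fsumEFin // -(fimfunE _ x).
rewrite ge0_integral_fsum//; last 2 first.
  - by move=> y; exact: emeasurable_funM.
  - by move=> y x Ey; apply: mule_ge0; [rewrite EFinM nnfun_muleindic_ge0|rewrite lee_fin].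
apply: eq_fsbigr => r rhn.
under [LHS]eq_integral do rewrite EFinM.
rewrite integralZl_indic_nnsfun => //.
under [RHS]eq_integral do rewrite EFinM -muleA.
rewrite ge0_integralZl//.
- under [in RHS]eq_integral do rewrite muleC.
  rewrite [in RHS](eq_integral ((EFin \o m) \_ (h @^-1` [set r]))); last first.
    by move=> x xE; rewrite epatch_indic.
  by rewrite -integral_mkcondr setTI -mu_m// integral_indic// setIT.
- by apply: emeasurable_funM => //; exact/measurable_EFinP.
- by move=> t Et; rewrite mule_ge0 ?lee_fin.
- by move: rhn; rewrite inE => -[t _ <-]; rewrite lee_fin.
Qed.

Lemma ge0_integral_density (f : T -> R) : measurable_fun setT f ->
  (forall x, (0 <= f x)%R) ->
  \int[mu]_x (f x)%:E = \int[lam]_x (f x * m x)%:E.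
Proof.
move=> mf f0.
have mfE : measurable_fun setT (EFin \o f) by exact/measurable_EFinP.
have mE : measurable_fun setT (EFin \o m) by exact/measurable_EFinP.
pose h := nnsfun_approx measurableT mfE.
have cvgh x : (EFin \o h n) x @[n --> \oo] --> (f x)%:E.
  by apply: (cvg_nnsfun_approx measurableT mfE) => // y _; rewrite lee_fin.
transitivity (lim (\int[mu]_x (h n x)%:E @[n --> \oo])).
  rewrite -monotone_convergence//=.
  - apply: eq_integral => x _; apply/esym/cvg_lim => //; exact: cvgh.
  - by move=> n; exact/measurable_EFinP/measurable_funTS.
  - by move=> n ? _; rewrite lee_fin.
  - by move=> ? _ ? ? mn; rewrite lee_fin; exact/lefP/nd_nnsfun_approx.
under eq_fun do rewrite integral_density_nnsfun.
rewrite -monotone_convergence//=.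
- apply: eq_integral => x _; rewrite EFinM; apply/cvg_lim => //.
  by apply: cvgeZr => //; exact: cvgh.
- move=> n; apply: emeasurable_funM => //; exact/measurable_EFinP.
- by move=> n ? _; rewrite mule_ge0 ?lee_fin.
- by move=> ? _ ? ? mn; rewrite lee_wpmul2r ?lee_fin//; exact/lefP/nd_nnsfun_approx.
Qed.

End Density.

Lemma continuous_modulus (R : realType) (T : topologicalType) (h : T -> R)
    (g : T -> T -> R) : (forall a, continuous (g a)) -> (forall a, g a a = 0) ->
  (forall a b, `|h a - h b| <= g a b) -> continuous h.
Proof.
move=> cg g0 hg a; apply/cvgrPdist_lt => e e0.
have /cvgrPdist_lt/(_ e e0) := cg a a; apply: filterS => b.
rewrite g0 sub0r normrN => /(le_lt_trans (ler_norm _)).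
exact: le_lt_trans.
Qed.

Transparent tint.

Section TorusDistance.
Variables (R : realType) (d : nat).
Local Notation TT := (torus R d).
Local Notation PP := (probability (torus R d) R).
Local Notation lam := (torus_lebesgue R d).

Lemma enorm_le_sum (v : 'rV[R]_d) : enorm v <= \sum_j `|v ord0 j|.
Proof.
have s0 : 0 <= \sum_j `|v ord0 j| by exact: sumr_ge0.
rewrite /enorm -[leRHS]ger0_norm// -sqrtr_sqr ler_wsqrtr// expr2 mulr_suml.
apply: ler_sum => j _; rewrite -real_normK ?num_real// expr2 ler_wpM2l//.
by rewrite (bigD1 j)//= lerDl sumr_ge0.
Qed.

Lemma tdist_le (a b : 'rV[R]_d) :
  tdist (tproj a) (tproj b) <= \sum_j `|a ord0 j - b ord0 j|.
Proof.
apply: (@le_trans _ _ (enorm (a - b))).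
  apply: ge_inf; last by exists a, b.
  by exists 0 => _ [a' [b' [_ _ ->]]]; exact: sqrtr_ge0.
apply: le_trans (enorm_le_sum _) _.
by apply: ler_sum => j _; rewrite !mxE.
Qed.

Lemma tdist_diam (x y : TT) : tdist x y <= d%:R.
Proof.
have [a <- ha] := tproj_unit_cube x; have [b <- hb] := tproj_unit_cube y.
apply: le_trans (tdist_le a b) _.
rewrite -[d in leRHS]card_ord -sum1_card natr_sum ler_sum// => j _.
have /andP[a0 a1] := ha j; have /andP[b0 b1] := hb j.
by rewrite ler_distl; apply/andP; split; lra.
Qed.

Lemma tdist_refl (x : TT) : tdist x x = 0.
Proof.
rewrite -(tprojK x); apply/eqP; rewrite eq_le; apply/andP; split.
  by apply: le_trans (tdist_le _ _) _; rewrite big1// => j _; rewrite subrr normr0.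
apply: lb_le_inf; last by move=> _ [a' [b' [_ _ ->]]]; exact: sqrtr_ge0.
by exists (enorm (repr x - repr x)), (repr x), (repr x).
Qed.

Lemma lip_continuous (phi : TT -> R) :
  (forall x y, `|phi x - phi y| <= tdist x y) -> continuous phi.
Proof.
move=> lip; apply/continuous_torusP.
apply: (@continuous_modulus _ _ _ (fun a b : 'rV[R]_d => \sum_j `|a ord0 j - b ord0 j|)).
- move=> a; apply: continuous_sumr => j; apply: cont_norm.
  by apply: contB; [exact: contC|exact: coord_continuous].
- by move=> a; rewrite big1// => j _; rewrite subrr normr0.
- by move=> a b; exact: le_trans (lip _ _) (tdist_le _ _).
Qed.

Variables (mu nu : PP) (m n : TT -> R).
Hypotheses (hm : has_density mu m) (hn : has_density nu n).
Hypotheses (cm : continuous m) (cn : continuous n).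

Lemma density_tint1 : tint m = 1.
Proof. by have [[_ _ h] _] := hm; rewrite /tint /Rintegral h. Qed.

(** The constant M that bounds phi makes phi + M nonnegative, and integrates to M
    on both sides. *)
Lemma Rintegral_density (phi : TT -> R) : continuous phi ->
  \int[mu]_x phi x = tint (fun x => phi x * m x).
Proof.
move=> cphi; have [M M0 hM] := torus_bounded cphi.
have [[mm m0 _] mum] := hm.
have mphi := torus_measurable cphi.
have cphiM : continuous (fun x => phi x + M) by apply: contD => //; exact: contC.
have h0 x : 0 <= phi x + M.
  by rewrite -lerBlDr sub0r; have := hM x; rewrite ler_norml => /andP[].
have E := ge0_integral_density m0 mm mum (torus_measurable cphiM) h0.
have : \int[mu]_x (phi x + M) = tint (fun x => (phi x + M) * m x).
  by rewrite /tint /Rintegral E.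
have imu : mu.-integrable setT (EFin \o phi).
  apply: measurable_bounded_integrable => //.
    by rewrite (@le_lt_trans _ _ 1%E) ?ltry// probability_le1.
  exists M; split; first exact: num_real.
  by move=> y My x _ /=; rewrite (le_trans (hM x))// ltW.
have imuM : mu.-integrable setT (EFin \o (fun=> M)).
  apply: measurable_bounded_integrable => //.
    by rewrite (@le_lt_trans _ _ 1%E) ?ltry// probability_le1.
  by exists `|M|; split => // y My x _ /=; exact: ltW.
rewrite RintegralD// Rintegral_cst//.
have -> : (mu : {measure set TT -> \bar R}) setT = 1%E by exact: probability_setT.
under [X in _ = tint X]eq_fun do rewrite mulrDl.
rewrite tintD ?tintZ ?density_tint1//; [by move/addIr|exact: contM|exact: contZ].
Qed.

End TorusDistance.

Opaque tint.

(** Both densities have mass 1, so a test function may be lowered by its value at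
    one point; it is then bounded by the diameter of the torus. *)
Lemma d1_le_L1 (R : realType) (d : nat) (mu nu : probability (torus R d) R)
    (m n : torus R d -> R) :
  has_density mu m -> has_density nu n -> continuous m -> continuous n ->
  0 <= d1 mu nu <= d%:R * tint (fun x => `|m x - n x|).
Proof.
move=> hm hn cm cn.
set S := [set r | exists2 phi : torus R d -> R,
    forall x y, `|phi x - phi y| <= tdist x y &
    r = \int[mu]_x phi x - \int[nu]_x phi x].
have ubS : ubound S (d%:R * tint (fun x => `|m x - n x|)).
  move=> _ [phi lip ->]; have cphi := lip_continuous lip.
  rewrite (Rintegral_density hm cm cphi) (Rintegral_density hn cn cphi).
  pose x0 := tproj (0 : 'rV[R]_d).
  have cmn : continuous (fun x => m x - n x) by exact: contB.
  have cp : continuous (fun x => phi x - phi x0) by apply: contB => //; exact: contC.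
  have -> : tint (fun x => phi x * m x) - tint (fun x => phi x * n x) =
      tint (fun x => (phi x - phi x0) * (m x - n x)).
    have -> : (fun x => (phi x - phi x0) * (m x - n x)) =
        (fun x => (phi x * m x - phi x * n x) - phi x0 * (m x - n x)).
      by apply/funext => x; ring.
    have c1 : continuous (fun x => phi x * m x) by exact: contM.
    have c2 : continuous (fun x => phi x * n x) by exact: contM.
    rewrite tintB ?tintB ?tintZ ?tintB//; [|exact: contB|exact: contZ].
    by rewrite (density_tint1 hm) (density_tint1 hn) subrr mulr0 subr0.
  have cnorm : continuous (fun x => `|m x - n x|) by exact: cont_norm.
  rewrite -tintZ//; apply: tint_le; [exact: contM|exact: contZ|move=> x].
  rewrite (le_trans (ler_norm _))// normrM ler_wpM2r//.
  by rewrite (le_trans (lip _ _))// tdist_diam.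
have S0 : S 0.
  exists (fun=> 0) => [x y|]; last by rewrite !Rintegral_cst// !mul0r subrr.
  rewrite subrr normr0; apply: lb_le_inf.
    by exists (enorm (repr x - repr y)), (repr x), (repr y); rewrite !tprojK.
  by move=> _ [a' [b' [_ _ ->]]]; exact: sqrtr_ge0.
rewrite /d1 -/S; apply/andP; split.
  by apply: sup_upper_bound => //; split;
    [exists 0|exists (d%:R * tint (fun x => `|m x - n x|))].
by apply: ge_sup => //; exists 0.
Qed.

(** * Energy identities *)

Lemma jcont_eq (R : realType) (U : topologicalType) (I : set R) (w y : R -> U -> R) :
  (forall t x, I t -> w t x = y t x) -> jcontinuous I w -> jcontinuous I y.
Proof.
move=> wy; apply: subspace_eq_continuous => -[t x]; rewrite inE => -[/= It _].
exact: wy.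
Qed.

Section Differences.
Variables (R : realType) (d : nat).
Local Notation TT := (torus R d).
Local Notation ee i := (delta_mx ord0 i : 'rV[R]_d).
Implicit Types (phi psi : TT -> R) (i : 'I_d) (I : set R).

Lemma tpartialB phi psi i x : tderivable i phi x -> tderivable i psi x ->
  tderivable i (fun y => phi y - psi y) x /\
  tpartial i (fun y => phi y - psi y) x = tpartial i phi x - tpartial i psi x.
Proof.
by move=> /is_derive_repr dphi /is_derive_repr dpsi; apply: tderivable_repr.
Qed.

Lemma tpartial_cst (c : R) i x :
  tderivable i (fun _ : TT => c) x /\ tpartial i (fun _ : TT => c) x = 0.
Proof. apply: tderivable_repr; exact: (is_derive_cst c). Qed.

Lemma C12_cst I (c : R) : class_C12 I (fun _ (_ : TT) => c).
Proof.
have E i : (fun _ : R => tpartial i (fun _ : TT => c)) = (fun _ _ => 0).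
  by apply/funext => t; apply/funext => x; have [] := tpartial_cst c i x.
split.
- split; first by move=> t x _; exact: derivable_cst.
  apply: (@jcont_eq _ _ _ (fun _ _ => 0)); last exact: jcontC.
  by move=> t x _; rewrite derive_cst.
- move=> i; split; first by move=> t x _; have [] := tpartial_cst c i x.
  by rewrite E; exact: jcontC.
- move=> i j; have Ej t := congr1 (fun h => h t) (E j).
  split.
    by move=> t x _; rewrite (Ej t); have [] := tpartial_cst 0 i x.
  rewrite (_ : (fun t => _) = (fun _ _ => 0)); first exact: jcontC.
  by apply/funext => t; rewrite (Ej t); apply/funext => x; have [] := tpartial_cst 0 i x.
Qed.

Lemma C12B I (w y : R -> TT -> R) : class_C12 I w -> class_C12 I y ->
  class_C12 I (fun t x => w t x - y t x).
Proof.
move=> [[dw cdw] pw ppw] [[dy cdy] py ppy].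
have E j t : I t -> tpartial j (fun x => w t x - y t x) =
    (fun x => tpartial j (w t) x - tpartial j (y t) x).
  move=> It; apply/funext => x; have [h1 _] := pw j; have [h2 _] := py j.
  by have [] := tpartialB (h1 t x It) (h2 t x It).
split.
- split; first by move=> t x It; apply: derivableB; [exact: dw|exact: dy].
  apply: (jcont_eq _ (jcontB cdw cdy)) => t x It.
  by rewrite deriveB//; [exact: dw|exact: dy].
- move=> i; have [h1 c1] := pw i; have [h2 c2] := py i; split.
    by move=> t x It; have [] := tpartialB (h1 t x It) (h2 t x It).
  by apply: (jcont_eq _ (jcontB c1 c2)) => t x It; rewrite E.
- move=> i j; have [h1 c1] := ppw i j; have [h2 c2] := ppy i j; split.
    by move=> t x It; rewrite E//; have [] := tpartialB (h1 t x It) (h2 t x It).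
  apply: (jcont_eq _ (jcontB c1 c2)) => t x It; rewrite E//.
  by have [] := tpartialB (h1 t x It) (h2 t x It).
Qed.

End Differences.

Section Green.
Variables (R : realType) (d : nat).
Local Notation TT := (torus R d).
Implicit Types (phi psi : TT -> R) (i : 'I_d) (I : set R) (w : R -> TT -> R).

(** What a function of class C^{1,2} provides at a fixed time. *)
Definition sliceC2 (phi : TT -> R) : Prop :=
  continuous phi /\
  forall i, [/\ forall x, tderivable i phi x, continuous (tpartial i phi),
    forall x, tderivable i (tpartial i phi) x &
    continuous (tpartial i (tpartial i phi))].

Lemma class_C12_slice I w t : jcontinuous I w -> class_C12 I w -> I t ->
  sliceC2 (w t).
Proof.
move=> cw [_ pw ppw] It; split; first exact: jcontinuous_slice cw It.
move=> i; have [h1 c1] := pw i; have [h2 c2] := ppw i i; split.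
- by move=> x; exact: h1.
- exact: (jcontinuous_slice c1 It).
- by move=> x; exact: h2.
- exact: (jcontinuous_slice c2 It).
Qed.

Lemma laplacian_continuous phi : sliceC2 phi -> continuous (laplacian phi).
Proof. by move=> [_ h]; apply: continuous_sumr => i; have [] := h i. Qed.

Lemma tint_green phi psi : sliceC2 phi -> sliceC2 psi ->
  tint (fun x => phi x * - laplacian psi x) =
  \sum_i tint (fun x => tpartial i phi x * tpartial i psi x).
Proof.
move=> [cphi hphi] [cpsi hpsi].
rewrite (_ : (fun x => _) = (fun x =>
    \sum_i - 1 * (phi x * tpartial i (tpartial i psi) x))); last first.
  apply/funext => x; rewrite mulrN /laplacian mulr_sumr -sumrN.
  by apply: eq_bigr => i _; rewrite mulN1r.
have cs i : continuous (fun x => phi x * tpartial i (tpartial i psi) x).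
  by apply: contM => //; have [] := hpsi i.
rewrite tint_sum; last by move=> i; exact: contZ.
apply: eq_bigr => i _; rewrite tintZ//.
have [? ? ? ?] := hphi i; have [? ? ? ?] := hpsi i.
by rewrite tint_by_parts2// mulN1r opprK.
Qed.

Lemma L2_is_derive I w t : nbhs t I -> jcontinuous I w -> class_C12 I w ->
  is_derive t (1 : R) (fun s => tint (fun x => w s x ^+ 2))
    (2 * tint (fun x => 'D_1 (w ^~ x) t * w t x)).
Proof.
move=> nI cw [[dw cdw] _ _].
apply: (@tint_is_derive _ _ I w (fun t x => 'D_1 (w ^~ x) t) w _ t) => //.
- by move=> s Is; exact: jcontinuous_slice cw Is.
- by move=> s x Is; apply: derivableP; exact: dw.
move=> s Is; have It := nbhs_singleton nI.
have cs := jcontinuous_slice cw Is; have ct := jcontinuous_slice cw It.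
rewrite -tintB; [|exact: contM|exact: contM].
by congr tint; apply/funext => x; ring.
Qed.

(** Green's formula writes the increment of the energy between times s and t as
    <w s - w t, - Laplacian (w s + w t)>. *)
Lemma dirichlet_is_derive I w t : nbhs t I -> jcontinuous I w ->
  class_C12 I w ->
  is_derive t (1 : R) (fun s => \sum_i tint (fun x => tpartial i (w s) x ^+ 2))
    (2 * tint (fun x => 'D_1 (w ^~ x) t * - laplacian (w t) x)).
Proof.
move=> nI cw C12; have [[dw cdw] _ ppw] := C12.
apply: (@tint_is_derive _ _ I w (fun t x => 'D_1 (w ^~ x) t)
  (fun t x => - laplacian (w t) x) _ t) => //.
- apply: (@jcontN _ _ I (fun t x => laplacian (w t) x)).
  apply: (@jcont_sum _ _ I d (fun i t x => tpartial i (tpartial i (w t)) x)) => i.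
  by have [] := ppw i i.
- by move=> s Is; exact: jcontinuous_slice cw Is.
- by move=> s x Is; apply: derivableP; exact: dw.
move=> s Is; have It := nbhs_singleton nI.
have Ss := class_C12_slice cw C12 Is; have St := class_C12_slice cw C12 It.
have cs := Ss.1; have ct := St.1.
have ls := contN (laplacian_continuous Ss); have lt := contN (laplacian_continuous St).
have css := contM cs ls; have cst := contM cs lt.
have cts := contM ct ls; have ctt := contM ct lt.
pose S p q := \sum_(i < d) tint (fun x => tpartial i (w p) x * tpartial i (w q) x).
have Sts : S t s = S s t.
  by apply: eq_bigr => i _; congr tint; apply/funext => x; rewrite mulrC.
have e1 : tint (fun x => w s x * - laplacian (w s) x + w s x * - laplacian (w t) x)
    = S s s + S s t.
  exact: etrans (tintD css cst) (congr2 +%R (tint_green Ss Ss) (tint_green Ss St)).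
have e2 : tint (fun x => w t x * - laplacian (w s) x + w t x * - laplacian (w t) x)
    = S t s + S t t.
  exact: etrans (tintD cts ctt) (congr2 +%R (tint_green St Ss) (tint_green St St)).
have e3 := tintB (contD css cst) (contD cts ctt).
have e4 : tint (fun x => (w s x - w t x) * (- laplacian (w s) x + - laplacian (w t) x))
    = (S s s + S s t) - (S t s + S t t).
  apply: etrans (etrans e3 (congr2 (fun p q : R => p - q) e1 e2)).
  have F (a b c e : R) : (a - b) * (c + e) = (a * c + a * e) - (b * c + b * e) by ring.
  exact: (congr1 (@tint R d) (funext (fun x => F (w s x) (w t x) _ _))).
apply: etrans (esym e4); rewrite Sts.
have sq r : \sum_(i < d) tint (fun x => tpartial i (w r) x ^+ 2) = S r r.
  by apply: eq_bigr => i _; congr tint; apply/funext => x; rewrite expr2.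
apply: etrans (congr2 (fun p q : R => p - q) (sq s) (sq t)) _.
have F (a b c : R) : a - c = (a + b) - (b + c) by ring.
exact: F.
Qed.

End Green.

Section TintForms.
Variables (R : realType) (d : nat).
Local Notation TT := (torus R d).

Lemma tint_quadratic_ge0 (a b : TT -> R) (r : R) : continuous a -> continuous b ->
  0 <= tint (fun x => a x ^+ 2) + 2 * r * tint (fun x => a x * b x)
       + r ^+ 2 * tint (fun x => b x ^+ 2).
Proof.
move=> ca cb.
have caa := contM ca ca; have cab := contM ca cb; have cbb := contM cb cb.
have := @tint_ge0 R d (fun x => (a x + r * b x) ^+ 2) (fun x => sqr_ge0 _).
rewrite (_ : (fun x => _) = (fun x => a x * a x + 2 * r * (a x * b x)
  + r ^+ 2 * (b x * b x))); last by apply/funext => x; ring.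
rewrite tintD; [|by apply: contD => //; exact: contZ|exact: contZ].
rewrite tintD//; last exact: contZ.
by rewrite !tintZ.
Qed.

(** The quadratic form at r = - tint `|a| is the difference of the two sides. *)
Lemma tint_L1_le_L2 (a : TT -> R) : continuous a ->
  tint (fun x => `|a x|) ^+ 2 <= tint (fun x => a x ^+ 2).
Proof.
move=> ca; have cn := cont_norm ca.
have := tint_quadratic_ge0 (- tint (fun x => `|a x|)) cn (@contC R TT 1).
rewrite (_ : (fun x => `|a x| ^+ 2) = (fun x => a x ^+ 2)); last first.
  by apply/funext => x; rewrite real_normK ?num_real.
rewrite (_ : (fun x => `|a x| * 1) = (fun x => `|a x|)); last first.
  by apply/funext => x; rewrite mulr1.
by rewrite expr1n tint_cst; nra.
Qed.

End TintForms.

(** * Quadratic estimates *)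

Lemma sqr_sum_le (R : realType) n (a : 'I_n -> R) :
  (\sum_j a j) ^+ 2 <= n%:R * \sum_j a j ^+ 2.
Proof.
rewrite expr2 big_distrlr/=.
set Q := \sum_j a j ^+ 2.
have inner i : \sum_j (a i ^+ 2 + a j ^+ 2) / 2 = (n%:R * a i ^+ 2 + Q) / 2.
  by rewrite -mulr_suml big_split/= sumr_const card_ord mulr_natl.
have -> : n%:R * Q = \sum_i \sum_j (a i ^+ 2 + a j ^+ 2) / 2.
  rewrite (eq_bigr _ (fun i _ => inner i)) -mulr_suml big_split/= -mulr_sumr -/Q.
  by rewrite sumr_const card_ord -[Q *+ n]mulr_natl; field.
apply: ler_sum => i _; apply: ler_sum => j _.
have := sqr_ge0 (a i - a j); nra.
Qed.

Lemma finite_bound (R : realType) n (Z : Type) (Q : Z -> Prop) (h : 'I_n -> Z -> R) :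
  (forall i, exists2 M : R, 0 < M & forall z, Q z -> `|h i z| <= M) ->
  exists2 M : R, 0 < M & forall i z, Q z -> `|h i z| <= M.
Proof.
move=> hb; have /choice[M hM] : forall i, exists M : R, 0 < M /\
    forall z, Q z -> `|h i z| <= M.
  by move=> i; have [M M0 hM] := hb i; exists M.
exists (\sum_i M i + 1).
  by rewrite ltr_wpDl// sumr_ge0// => j _; have [/ltW] := hM j.
move=> i z Qz; have [_ /(_ z Qz) h1] := hM i; apply: (le_trans h1).
rewrite (bigD1 i)//= -addrA lerDl addr_ge0// sumr_ge0// => k _.
by have [/ltW] := hM k.
Qed.

Lemma cont_comp (R : realType) (U : topologicalType) n (F : U -> 'rV[R]_n -> R)
    (p : U -> 'rV[R]_n) :
  continuous (fun z : U * 'rV[R]_n => F z.1 z.2) ->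
  (forall j, continuous (fun x => p x ord0 j)) -> continuous (fun x => F x (p x)).
Proof.
move=> cF cp x; apply: (@cvg_comp _ _ _ (fun x => (x, p x))
  (fun z : U * 'rV[R]_n => F z.1 z.2) _ (nbhs (x, p x)) _ _ (cF (x, p x))).
have h1 : (fun x : U => x) @ x --> x by exact: cvg_id.
have h2 : p y @[y --> x] --> p x by apply: cvg_rV => j; exact: cp.
exact: cvg_pair h1 h2.
Qed.

Section SpatialTools.
Variables (R : realType) (d : nat).
Local Notation TT := (torus R d).
Local Notation ee i := (delta_mx ord0 i : 'rV[R]_d).

Lemma tint_sqr_bound (a b : TT -> R) (G : 'I_d -> TT -> R) (al be ga : R) :
  continuous a -> continuous b -> (forall j, continuous (G j)) ->
  0 <= al -> 0 <= be -> 0 <= ga ->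
  (forall x, `|a x| <= al * `|b x| + be * \sum_j `|G j x| + ga) ->
  tint (fun x => a x ^+ 2) <= 3 * al ^+ 2 * tint (fun x => b x ^+ 2) +
    3 * be ^+ 2 * d%:R * \sum_j tint (fun x => G j x ^+ 2) + 3 * ga ^+ 2.
Proof.
move=> ca cb cG al0 be0 ga0 ab.
have caa : continuous (fun x => a x ^+ 2) by exact: (contM ca ca).
have cbb : continuous (fun x => b x ^+ 2) by exact: (contM cb cb).
have cGG j : continuous (fun x => G j x ^+ 2) by exact: (contM (cG j) (cG j)).
have cS : continuous (fun x => \sum_j G j x ^+ 2) by exact: continuous_sumr.
have c1 := contZ (r := 3 * al ^+ 2) cbb.
have c2 := contZ (r := 3 * be ^+ 2 * d%:R) cS.
have c3 := @contC R TT (3 * ga ^+ 2).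
have e1 := tintZ (3 * al ^+ 2) cbb.
have e2 := tintZ (3 * be ^+ 2 * d%:R) cS.
have e3 := tint_cst d (3 * ga ^+ 2).
rewrite -(tint_sum cGG) -e1 -e2 -e3 -(tintD c1 c2) -(tintD (contD c1 c2) c3).
apply: tint_le => //; first exact: contD (contD c1 c2) c3.
move=> x; rewrite -real_normK ?num_real//.
have b2 : `|b x| ^+ 2 = b x ^+ 2 by rewrite real_normK ?num_real.
have S2 : (\sum_j `|G j x|) ^+ 2 <= d%:R * \sum_j G j x ^+ 2.
  rewrite (le_trans (sqr_sum_le _))// ler_wpM2l//.
  by rewrite ler_sum// => j _; rewrite real_normK ?num_real.
rewrite -b2 -mulrA [X in _ <= _ + X + _](_ : _ =
    3 * (be ^+ 2 * (d%:R * \sum_j G j x ^+ 2))); last by rewrite !mulrA.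
have s0 : 0 <= \sum_j `|G j x| by exact: sumr_ge0.
have S3 : be ^+ 2 * (\sum_j `|G j x|) ^+ 2 <= be ^+ 2 * (d%:R * \sum_j G j x ^+ 2).
  by rewrite ler_wpM2l// sqr_ge0.
have h1 : `|a x| ^+ 2 <= (al * `|b x| + be * \sum_j `|G j x| + ga) ^+ 2.
  by rewrite ler_sqr ?nnegrE// ?addr_ge0// mulr_ge0.
apply: (le_trans h1).
have F (p q r : R) : (p + q + r) ^+ 2 <= 3 * p ^+ 2 + 3 * q ^+ 2 + 3 * r ^+ 2.
  have := sqr_ge0 (p - q); have := sqr_ge0 (p - r); have := sqr_ge0 (q - r); nra.
apply: (le_trans (F _ _ _)).
by rewrite !exprMn -mulrA lerD2r lerD2l ler_wpM2l.
Qed.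

Lemma gradE (phi : TT -> R) (j : 'I_d) :
  (fun y => grad phi y ord0 j) = tpartial j phi.
Proof. by apply/funext => y; rewrite mxE. Qed.

(** The divergence is a sum of limits that could fail to exist; here they are
    shown to be genuine and continuous partial derivatives, which integration by
    parts requires. *)
Lemma flux_C1 (F : TT -> 'rV[R]_d -> R) (i : 'I_d) (m phi : TT -> R) :
  class_C1 F -> continuous m -> (forall x, tderivable i m x) ->
  continuous (tpartial i m) ->
  (forall j, continuous (tpartial j phi)) ->
  (forall j x, tderivable i (tpartial j phi) x) ->
  (forall j, continuous (tpartial i (tpartial j phi))) ->
  [/\ continuous (fun y => m y * F y (grad phi y)),
      forall x, tderivable i (fun y => m y * F y (grad phi y)) x &
      continuous (tpartial i (fun y => m y * F y (grad phi y)))].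
Proof.
move=> C1F cm dm cdm cp dp cdp.
have cg j : continuous (fun y => grad phi y ord0 j) by rewrite gradE.
have [cF hF] := C1F.
have cFg : continuous (fun y => F y (grad phi y)) by exact: cont_comp.
have dFg x : tderivable i (fun y => F y (grad phi y)) x /\
  tpartial i (fun y => F y (grad phi y)) x =
    tpartial i (F ^~ (grad phi x)) x +
    \sum_j 'D_(ee j) (F x) (grad phi x) * tpartial i (tpartial j phi) x.
  have dgj j : tderivable i (fun y => grad phi y ord0 j) x by rewrite gradE.
  have [h1 h2] := C1_chain_rule C1F dgj; split => //; rewrite h2; congr (_ + _).
  by apply: eq_bigr => j _; rewrite gradE.
have cdFg : continuous (tpartial i (fun y => F y (grad phi y))).
  have -> : tpartial i (fun y => F y (grad phi y)) = (fun x =>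
    tpartial i (F ^~ (grad phi x)) x +
    \sum_j 'D_(ee j) (F x) (grad phi x) * tpartial i (tpartial j phi) x).
    by apply/funext => x; have [] := dFg x.
  have [_ _ cFi _] := hF i.
  apply: contD; first exact: (@cont_comp R TT d (fun x p => tpartial i (F ^~ p) x)).
  apply: continuous_sumr => j; apply: contM => //.
  have [_ _ _ cFj] := hF j.
  exact: (@cont_comp R TT d (fun x p => 'D_(ee j) (F x) p)).
have M x := tpartialM (dm x) (dFg x).1.
split; first exact: contM.
  by move=> x; have [] := M x.
have -> : tpartial i (fun y => m y * F y (grad phi y)) = (fun x =>
   m x * tpartial i (fun y => F y (grad phi y)) x +
   F x (grad phi x) * tpartial i m x).
  by apply/funext => x; have [] := M x.
by apply: contD; exact: contM.
Qed.

End SpatialTools.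

(** * Backward uniqueness for the system *)

Lemma laplacianE (R : realType) (d : nat) (phi : torus R d -> R) x :
  laplacian phi x = \sum_i tpartial i (tpartial i phi) x.
Proof. by []. Qed.

Lemma divergenceE (R : realType) (d : nat) (V : torus R d -> 'rV[R]_d) x :
  divergence V x = \sum_i tpartial i (fun y => V y ord0 i) x.
Proof. by []. Qed.

Lemma subtract_equations (R : realType) (a b p q r s r' s' y z w : R) :
  y = a - b -> z = p - q -> w = r' - s' -> r = r' -> s = s' ->
  a - p - r = 0 -> b - q - s = 0 -> y = z + w.
Proof. by move=> -> -> -> -> ->; lra. Qed.

Lemma half_square_le (R : realType) (a b q : R) :
  0 <= a + 2 * 2 * b + 2 ^+ 2 * q -> 2 * (- b - q) <= a / 2.
Proof. lra. Qed.

(** For a solution w of w' = A w + h, with A = - Laplacian, take D = w' and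
    l = Laplacian w: then D + l = h and D - l = 2 (A w + h/2). Everything that
    carleman_gronwall requires is a combination of scalar products of D - l, D + l
    and w. *)
Lemma carleman_gram (R : realType) (d : nat) (D w l : torus R d -> R) (E : R) :
  continuous D -> continuous w -> continuous l ->
  E = tint (fun x => w x * - l x) ->
  exists B c e,
    [/\ 2 * tint (fun x => D x * w x) = 2 * c + e,
        2 * tint (fun x => D x * - l x) =
          2 * B - tint (fun x => (D x + l x) ^+ 2) / 2,
        E = c - e / 2,
        forall psi, 0 <= B - 2 * psi * c + psi ^+ 2 * tint (fun x => w x ^+ 2) &
        forall g, 0 <= tint (fun x => (D x + l x) ^+ 2) + 4 * g * e +
           4 * g ^+ 2 * tint (fun x => w x ^+ 2)].
Proof.
move=> cD cw cl ->.
pose h x := D x + l x; pose b x := D x - l x.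
have ch : continuous h by exact: contD.
have cb : continuous b by exact: contB.
have cbw := contM cb cw; have chw := contM ch cw.
have cbb := contM cb cb; have chh := contM ch ch.
exists (tint (fun x => b x * b x) / 4), (tint (fun x => b x * w x) / 2),
  (tint (fun x => h x * w x)).
have sq (k : torus R d -> R) : tint (fun x => k x ^+ 2) = tint (fun x => k x * k x).
  by congr tint; apply/funext => x; rewrite expr2.
have lin (p q r : torus R d -> R) (al be : R) : continuous p -> continuous q ->
    (forall x, r x = al * p x + be * q x) ->
    tint r = al * tint p + be * tint q.
  move=> cp cq rE; rewrite (_ : r = (fun x => al * p x + be * q x)); last exact/funext.
  have cap : continuous (fun x => al * p x) by exact: contZ.
  have cbq : continuous (fun x => be * q x) by exact: contZ.
  by rewrite (tintD cap cbq) (tintZ al cp) (tintZ be cq).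
have e1 : tint (fun x => D x * w x) =
    2^-1 * tint (fun x => b x * w x) + 2^-1 * tint (fun x => h x * w x).
  by apply: lin => // x; rewrite /b /h; field.
have e2 : tint (fun x => D x * - l x) =
    4^-1 * tint (fun x => b x * b x) + - 4^-1 * tint (fun x => h x * h x).
  by apply: lin => // x; rewrite /b /h; field.
have e3 : tint (fun x => w x * - l x) =
    2^-1 * tint (fun x => b x * w x) + - 2^-1 * tint (fun x => h x * w x).
  by apply: lin => // x; rewrite /b /h; field.
have eh : tint (fun x => (D x + l x) ^+ 2) = tint (fun x => h x * h x) by exact: sq.
have ew := sq w; have eb := sq b; have ehh := sq h.
have qb r := tint_quadratic_ge0 r cb cw.
have qh r := tint_quadratic_ge0 r ch cw.
rewrite e1 e2 e3 eh.
split.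
- by field.
- by field.
- by field.
- move=> psi; have := qb (- (2 * psi)); rewrite eb ew; lra.
- move=> g; have := qh (2 * g); rewrite ehh ew; lra.
Qed.

Opaque tpartial laplacian divergence.

Lemma jcont_zero_end (R : realType) (U : topologicalType) (a b : R) (w : R -> U -> R) :
  a < b -> jcontinuous `[a, b] w ->
  (forall t x, a <= t < b -> w t x = 0) -> forall x, w b x = 0.
Proof.
move=> ab cw w0 x; apply/eqP; apply: contraT => wb.
have Ib : [set` `[a, b]] b by rewrite /= in_itv/= lexx ltW.
have wb0 : 0 < `|w b x| by rewrite normr_gt0.
have [A [B [/nbhs_ballP[r /= r0 rA] nB AB]]] := jcontinuous_near x cw Ib wb0.
pose s := Num.max a (b - r / 2).
have sb : s < b by rewrite gt_max ab/= ltrBlDr ltrDl divr_gt0.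
have as_ : a <= s by rewrite le_max lexx.
have As : A s.
  apply: rA; rewrite -ball_normE /ball_/= gtr0_norm ?subr_gt0//.
  have : b - r / 2 <= s by rewrite le_max lexx orbT.
  by lra.
have := AB s x As _ (nbhs_singleton nB).
rewrite w0 ?as_// sub0r normrN ltxx.
by rewrite /= in_itv/= as_ ltW// => /(_ isT).
Qed.

Section Solutions.
Variables (R : realType) (d : nat).
Local Notation TT := (torus R d).
Local Notation PP := (probability (torus R d) R).
Local Notation ee i := (delta_mx ord0 i : 'rV[R]_d).
Variables (H : TT -> 'rV[R]_d -> R) (f g : TT -> PP -> R) (t0 T : R) (m0 : TT -> R).

(** The estimates refer to the flow of measures, which mfg_solution hides under a
    quantifier. *)
Definition mfg_solution_with (u m : R -> TT -> R) (mu : R -> PP) : Prop :=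
  [/\ [/\ continuous_TX `[t0, T] u, class_C12 `]t0, T[ u &
          forall i, (forall t x, t0 <= t < T -> tderivable i (u t) x) /\
            continuous_TX `[t0, T[ (fun t => tpartial i (u t))],
      continuous_TX `[t0, T] m /\ class_C12 `]t0, T[ m,
      forall t, t0 <= t <= T -> has_density (mu t) (m t),
      forall t x, t0 < t < T ->
        - 'D_1 (u ^~ x) t - laplacian (u t) x + H x (grad (u t) x)
          = f x (mu t) /\
        'D_1 (m ^~ x) t - laplacian (m t) x
          - divergence (fun y => m t y *: grad_p H y (grad (u t) y)) x = 0 &
      (forall x, m t0 x = m0 x) /\ (forall x, u T x = g x (mu T))].

(** The gradient is not assumed to be continuous up to T, hence the smaller final
    time t1. *)
Lemma gradient_bound u m mu t1 : mfg_solution_with u m mu -> t1 < T ->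
  exists2 M : R, 0 < M & forall i t x, t0 <= t <= t1 -> `|tpartial i (u t) x| <= M.
Proof.
move=> [[_ _ hD] _ _ _ _] t1T.
have [i|M M0 hM] := @finite_bound R d (R * TT) (fun z => t0 <= z.1 <= t1)
  (fun i z => tpartial i (u z.1) z.2).
  have [_ cD] := hD i.
  have cD1 : jcontinuous `[t0, t1] (fun t => tpartial i (u t)).
    apply: jcontS cD => t /=; rewrite !in_itv/= => /andP[-> /le_lt_trans]; exact.
  have [M M0 hM] := jcont_bounded (@torus_compact R d) (@segment_compact R t0 t1) cD1.
  by exists M => // -[t x] /= ht; apply: hM; rewrite /= in_itv.
by exists M => // i t x ht; exact: (hM i (t, x)).
Qed.

Lemma density_bound u m mu t1 : mfg_solution_with u m mu -> t1 < T ->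
  exists2 M : R, 0 < M & forall t x, t0 <= t <= t1 -> `|m t x| <= M.
Proof.
move=> [_ [cm _] _ _ _] t1T.
have cm1 : jcontinuous `[t0, t1] m.
  apply: jcontS cm => t /=; rewrite !in_itv/= => /andP[-> /le_trans]; apply.
  exact: ltW.
have [M M0 hM] := jcont_bounded (@torus_compact R d) (@segment_compact R t0 t1) cm1.
by exists M => // t x ht; apply: hM; rewrite /= in_itv.
Qed.

Lemma coupling_le (h : TT -> PP -> R) : lipschitz_TP h ->
  exists2 L : R, 0 < L & forall x mu nu (m n : TT -> R),
    has_density mu m -> has_density nu n -> continuous m -> continuous n ->
    `|h x mu - h x nu| <= L * tint (fun y => `|m y - n y|).
Proof.
move=> [L hL]; exists ((`|L| + 1) * (d%:R + 1)).
  by rewrite mulr_gt0// ltr_wpDl.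
move=> x mu nu m n hm hn cm cn.
have /andP[d0 dle] := d1_le_L1 hm hn cm cn.
have K0 : 0 <= tint (fun y => `|m y - n y|) by apply: tint_ge0.
move: (tint _) K0 dle => K K0 dle.
have := hL x x mu nu; rewrite tdist_refl add0r => h1; apply: (le_trans h1).
have h2 : L * d1 mu nu <= (`|L| + 1) * d1 mu nu.
  by rewrite ler_wpM2r// (le_trans (ler_norm L))// lerDl.
apply: (le_trans h2); rewrite -mulrA ler_wpM2l ?addr_ge0//.
by rewrite (le_trans dle)// ler_wpM2r// lerDl.
Qed.

Lemma flux_slice u m mu i t : mfg_solution_with u m mu -> class_C2 H ->
  t0 < t < T ->
  [/\ continuous (fun y => m t y * 'D_(ee i) (H y) (grad (u t) y)),
      forall x, tderivable i (fun y => m t y * 'D_(ee i) (H y) (grad (u t) y)) x &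
      continuous (tpartial i (fun y => m t y * 'D_(ee i) (H y) (grad (u t) y)))].
Proof.
move=> [[_ [_ _ ppu] hD] [cm [_ pm _]] _ _ _] [_ C2H] ht.
have It : [set` `]t0, T[%R] t by rewrite /= in_itv.
have It0 : [set` `[t0, T[%R] t by rewrite /= in_itv/=; case/andP: ht => /ltW ->.
have ItT : [set` `[t0, T]%R] t.
  by rewrite /= in_itv/=; case/andP: ht => /ltW -> /ltW.
have [dm cdm] := pm i.
apply: (@flux_C1 R d (fun x p => 'D_(ee i) (H x) p) i (m t) (u t)).
- by have [] := C2H i.
- exact: (jcontinuous_slice cm ItT).
- by move=> x; exact: dm.
- exact: (jcontinuous_slice cdm It).
- by move=> j; have [_ h] := hD j; exact: (jcontinuous_slice h It0).
- by move=> j x; have [h _] := ppu i j; exact: h.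
- by move=> j; have [_ h] := ppu i j; exact: (jcontinuous_slice h It).
Qed.

Variables (u1 m1 u2 m2 : R -> TT -> R) (mu1 mu2 : R -> PP).
Hypotheses (S1 : mfg_solution_with u1 m1 mu1) (S2 : mfg_solution_with u2 m2 mu2).
Hypotheses (t0T : t0 < T) (hH : class_C2 H) (hf : lipschitz_TP f).
Hypothesis (hDu : forall x, grad (u1 t0) x = grad (u2 t0) x).

(** The gradients agree at t0, so u1 - u2 is constant there; removing the constant
    gives v the initial value 0 and changes neither its derivatives nor its
    equation. *)
Let c : R := u1 t0 (tproj 0) - u2 t0 (tproj 0).
Let v t x := u1 t x - u2 t x - c.
Let n t x := m1 t x - m2 t x.

Let cv : jcontinuous `[t0, T] v.
Proof.
have [[c1 _ _] _ _ _ _] := S1; have [[c2 _ _] _ _ _ _] := S2.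
exact: (jcontB (jcontB c1 c2) (@jcontC _ _ _ c)).
Qed.

Let cn : jcontinuous `[t0, T] n.
Proof.
have [_ [c1 _] _ _ _] := S1; have [_ [c2 _] _ _ _] := S2.
exact: (jcontB c1 c2).
Qed.

Let C12v : class_C12 `]t0, T[ v.
Proof.
have [[_ c1 _] _ _ _ _] := S1; have [[_ c2 _] _ _ _ _] := S2.
have h := C12B (C12B c1 c2) (@C12_cst R d [set` `]t0, T[%R] c).
exact: h.
Qed.

Let C12n : class_C12 `]t0, T[ n.
Proof.
have [_ [_ c1] _ _ _] := S1; have [_ [_ c2] _ _ _] := S2.
exact: (C12B c1 c2).
Qed.

Let dv i t x : t0 <= t < T -> tderivable i (v t) x /\
  tpartial i (v t) x = tpartial i (u1 t) x - tpartial i (u2 t) x.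
Proof.
move=> ht; have [[_ _ /(_ i)[h1 _]] _ _ _ _] := S1.
have [[_ _ /(_ i)[h2 _]] _ _ _ _] := S2.
have [h3 e3] := tpartialB (h1 t x ht) (h2 t x ht).
have [h4 e4] := tpartial_cst c i x.
have [h5 e5] := tpartialB h3 h4.
by split => //; apply: (etrans e5); rewrite e3 e4 subr0.
Qed.

Let cGv i : jcontinuous `[t0, T[ (fun t => tpartial i (v t)).
Proof.
have [[_ _ /(_ i)[_ h1]] _ _ _ _] := S1.
have [[_ _ /(_ i)[_ h2]] _ _ _ _] := S2.
apply: (jcont_eq _ (jcontB h1 h2)) => t x /=; rewrite in_itv/= => ht.
by have [_ ->] := dv i x ht.
Qed.

Let Gv0 i x : tpartial i (v t0) x = 0.
Proof.
have ht : t0 <= t0 < T by rewrite lexx.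
have [_ ->] := dv i x ht; have := hDu x => /rowP/(_ i).
by rewrite !mxE => ->; rewrite subrr.
Qed.

Let v0 x : v t0 x = 0.
Proof.
have ht : t0 <= t0 < T by rewrite lexx.
rewrite (@grad0_constant R d (v t0) _ _ x (tproj 0)); first by rewrite /v /c subrr.
  by move=> i y; have [] := dv i y ht.
by move=> i y; exact: Gv0.
Qed.

Let n0 x : n t0 x = 0.
Proof.
have [_ _ _ _ [h1 _]] := S1; have [_ _ _ _ [h2 _]] := S2.
by rewrite /n h1 h2 subrr.
Qed.

Let dtv t x : t0 < t < T ->
  'D_1 (v ^~ x) t = 'D_1 (u1 ^~ x) t - 'D_1 (u2 ^~ x) t.
Proof.
move=> ht; have It : [set` `]t0, T[%R] t by rewrite /= in_itv.
have [[_ [[h1 _] _ _] _] _ _ _ _] := S1.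
have [[_ [[h2 _] _ _] _] _ _ _ _] := S2.
have d1 := h1 t x It; have d2 := h2 t x It.
have dc : derivable (fun _ : R => c) t 1 by exact: derivable_cst.
apply: etrans (deriveB (derivableB d1 d2) dc) _.
by rewrite (deriveB d1 d2) derive_cst subr0.
Qed.

Let dtn t x : t0 < t < T ->
  'D_1 (n ^~ x) t = 'D_1 (m1 ^~ x) t - 'D_1 (m2 ^~ x) t.
Proof.
move=> ht; have It : [set` `]t0, T[%R] t by rewrite /= in_itv.
have [_ [_ [[h1 _] _ _]] _ _ _] := S1.
have [_ [_ [[h2 _] _ _]] _ _ _] := S2.
exact: deriveB (h1 t x It) (h2 t x It).
Qed.

Let lapB (w y : R -> TT -> R) (k : R) t x :
  class_C12 `]t0, T[ w -> class_C12 `]t0, T[ y -> t0 < t < T ->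
  laplacian (fun z => w t z - y t z - k) x = laplacian (w t) x - laplacian (y t) x.
Proof.
move=> [_ pw ppw] [_ py ppy] ht.
have It : [set` `]t0, T[%R] t by rewrite /= in_itv.
rewrite !laplacianE -sumrB; apply: eq_bigr => i _.
have -> : tpartial i (fun z => w t z - y t z - k) =
    (fun z => tpartial i (w t) z - tpartial i (y t) z).
  apply/funext => z; have [h1 _] := pw i; have [h2 _] := py i.
  have [h3 e3] := tpartialB (h1 t z It) (h2 t z It).
  have [h4 e4] := tpartial_cst k i z.
  have [_ e5] := tpartialB h3 h4.
  by apply: (etrans e5); rewrite e3 e4 subr0.
have [h1 _] := ppw i i; have [h2 _] := ppy i i.
by have [_ ->] := tpartialB (h1 t x It) (h2 t x It).
Qed.

Let Iint t : t0 < t < T -> [set` `]t0, T[%R] t.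
Proof. by rewrite /= in_itv. Qed.

Let energy t := \sum_i tint (fun x => tpartial i (v t) x ^+ 2).
Let mass t := tint (fun x => n t x ^+ 2).

Let energy_ge0 t : 0 <= energy t.
Proof. by apply: sumr_ge0 => i _; apply: tint_ge0 => x; exact: sqr_ge0. Qed.

Let mass_ge0 t : 0 <= mass t.
Proof. by apply: tint_ge0 => x; exact: sqr_ge0. Qed.

Let Sv t : t0 < t < T -> sliceC2 (v t).
Proof.
move=> /Iint It; apply: (class_C12_slice _ C12v It).
by apply: jcontS cv => s /=; rewrite !in_itv/= => /andP[/ltW -> /ltW ->].
Qed.

Let Sn t : t0 < t < T -> sliceC2 (n t).
Proof.
move=> /Iint It; apply: (class_C12_slice _ C12n It).
by apply: jcontS cn => s /=; rewrite !in_itv/= => /andP[/ltW -> /ltW ->].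
Qed.

Let cD1 (w : R -> TT -> R) t : class_C12 `]t0, T[ w -> t0 < t < T ->
  continuous (fun x => 'D_1 (w ^~ x) t).
Proof. by move=> [[_ cw] _ _] /Iint It; exact: (jcontinuous_slice cw It). Qed.

Let cm1 t : t0 <= t <= T -> continuous (m1 t).
Proof.
move=> ht; have [_ [h _] _ _ _] := S1.
by apply: (jcontinuous_slice h); rewrite /= in_itv.
Qed.

Let cm2 t : t0 <= t <= T -> continuous (m2 t).
Proof.
move=> ht; have [_ [h _] _ _ _] := S2.
by apply: (jcontinuous_slice h); rewrite /= in_itv.
Qed.

(** By the two equations for u the source of v is the difference of the
    Hamiltonians, controlled by |Dv|, minus that of the couplings, controlled by the
    L^1 distance of the densities. *)
Let source_bound t1 : t0 < t1 < T -> exists2 C : R, 0 <= C &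
  forall t, t0 < t < t1 ->
    tint (fun x => ('D_1 (v ^~ x) t + laplacian (v t) x) ^+ 2)
      <= C * (energy t + mass t).
Proof.
move=> /andP[t01 t1T].
have [M1 M10 hM1] := gradient_bound S1 t1T.
have [M2 M20 hM2] := gradient_bound S2 t1T.
have [L L0 hL] := C1_lipschitz hH.1 (M1 + M2).
have [Lf Lf0 hLf] := coupling_le hf.
exists (3 * L ^+ 2 * d%:R + 3 * Lf ^+ 2).
  by rewrite addr_ge0// !mulr_ge0// ?exprn_ge0// ltW.
move=> t /andP[h0 h1].
have ht : t0 < t < T by rewrite h0 (lt_trans h1).
have ht' : t0 <= t <= T by case/andP: ht => *; rewrite !ltW.
have ht1 : t0 <= t <= t1 by rewrite !ltW.
have ht0 : t0 <= t < T by rewrite ltW//=; case/andP: ht.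
have svt := Sv ht; have cnt := (Sn ht).1.
set K1 := tint (fun y => `|n t y|).
have K10 : 0 <= K1 by exact: tint_ge0.
have K1k : K1 ^+ 2 <= mass t by exact: tint_L1_le_L2.
have cs : continuous (fun x => 'D_1 (v ^~ x) t + laplacian (v t) x).
  by apply: contD; [exact: cD1 C12v ht|exact: laplacian_continuous svt].
have cG j : continuous (tpartial j (v t)) by have [_ /(_ j)[]] := svt.
have pw x : `|'D_1 (v ^~ x) t + laplacian (v t) x| <=
    0 * `|n t x| + L * (\sum_j `|tpartial j (v t) x|) + Lf * K1.
  have [[_ C1 _] _ den1 pde1 _] := S1; have [[_ C2 _] _ den2 pde2 _] := S2.
  have [e1 _] := pde1 t x ht; have [e2 _] := pde2 t x ht.
  have e3 := dtv x ht; have e4 := lapB c x C1 C2 ht.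
  have lf := hLf x _ _ _ _ (den1 t ht') (den2 t ht') (cm1 ht') (cm2 ht').
  have lh : `|H x (grad (u1 t) x) - H x (grad (u2 t) x)| <=
      L * \sum_j `|tpartial j (v t) x|.
    have E : \sum_j `|tpartial j (v t) x| =
        \sum_j `|grad (u1 t) x ord0 j - grad (u2 t) x ord0 j|.
      by apply: eq_bigr => j _; have [_ ->] := dv j x ht0; rewrite !mxE.
    rewrite E; apply: hL => j; rewrite mxE.
      by rewrite (le_trans (hM1 _ _ _ ht1))// lerDl ltW.
    by rewrite (le_trans (hM2 _ _ _ ht1))// lerDr ltW.
  have -> : 'D_1 (v ^~ x) t + laplacian (v t) x =
      (H x (grad (u1 t) x) - H x (grad (u2 t) x)) - (f x (mu1 t) - f x (mu2 t)).
    have F (a b p q h k r s y z : R) : y = a - b -> z = p - q ->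
        - a - p + h = r -> - b - q + k = s -> y + z = (h - k) - (r - s).
      by move=> -> -> <- <-; ring.
    exact: F e3 e4 e1 e2.
  rewrite mul0r add0r; apply: (le_trans (ler_normB _ _)); apply: lerD => //.
apply: le_trans (tint_sqr_bound cs cnt cG _ _ _ pw) _ => //.
- exact: ltW.
- by rewrite mulr_ge0// ltW.
rewrite expr0n/= mulr0 mul0r add0r exprMn -/(energy t).
have E0 := energy_ge0 t; have k0 := mass_ge0 t.
move: (energy t) (mass t) E0 k0 K1k => E k E0 k0 K1k.
have a0 : 0 <= 3 * L ^+ 2 * d%:R.
  by apply: mulr_ge0 => //; apply: mulr_ge0 => //; exact: sqr_ge0.
have b0 : 0 <= 3 * Lf ^+ 2 by apply: mulr_ge0 => //; exact: sqr_ge0.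
have b1 : 3 * (Lf ^+ 2 * K1 ^+ 2) <= 3 * Lf ^+ 2 * k by rewrite mulrA ler_wpM2l.
move: (3 * L ^+ 2 * d%:R) (3 * Lf ^+ 2) (3 * _) a0 b0 b1 => a b e a0 b0 b1.
rewrite mulrDr !mulrDl; have := mulr_ge0 a0 k0; have := mulr_ge0 b0 E0; lra.
Qed.

Let W i t y := m1 t y * 'D_(ee i) (H y) (grad (u1 t) y) -
  m2 t y * 'D_(ee i) (H y) (grad (u2 t) y).

(** With F the i-th derivative of H in p and F1, F2 its values along the two
    gradients, m1 F1 - m2 F2 = F1 (m1 - m2) + m2 (F1 - F2). *)
Let W_bound i t1 : t0 < t1 < T -> exists C : R, 0 <= C /\
  forall t, t0 < t < t1 ->
    tint (fun x => W i t x ^+ 2) <= C * (energy t + mass t).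
Proof.
move=> /andP[t01 t1T].
have [M1 M10 hM1] := gradient_bound S1 t1T.
have [M2 M20 hM2] := gradient_bound S2 t1T.
have [N N0 hN] := density_bound S2 t1T.
have C1F : class_C1 (fun x p => 'D_(ee i) (H x) p) by have [_ /(_ i)[]] := hH.
have [L L0 hL] := C1_lipschitz C1F (M1 + M2).
have [K K0 hK] := C1_bounded (M1 + M2) C1F.1.
exists (3 * K ^+ 2 + 3 * (N * L) ^+ 2 * d%:R); split.
  apply: addr_ge0; first by apply: mulr_ge0 => //; exact: sqr_ge0.
  by apply: mulr_ge0 => //; apply: mulr_ge0 => //; exact: sqr_ge0.
move=> t /andP[h0 h1].
have ht : t0 < t < T by rewrite h0 (lt_trans h1).
have ht' : t0 <= t <= T by case/andP: ht => *; rewrite !ltW.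
have ht1 : t0 <= t <= t1 by rewrite !ltW.
have ht0 : t0 <= t < T by rewrite ltW//=; case/andP: ht.
have svt := Sv ht; have cnt := (Sn ht).1.
have cG j : continuous (tpartial j (v t)) by have [_ /(_ j)[]] := svt.
have [cw1 _ _] := flux_slice i S1 hH ht.
have [cw2 _ _] := flux_slice i S2 hH ht.
have cW : continuous (W i t) by exact: contB cw1 cw2.
have pw x : `|W i t x| <=
    K * `|n t x| + (N * L) * (\sum_j `|tpartial j (v t) x|) + 0.
  have g1 j : `|grad (u1 t) x ord0 j| <= M1 + M2.
    by rewrite mxE (le_trans (hM1 _ _ _ ht1))// lerDl ltW.
  have g2 j : `|grad (u2 t) x ord0 j| <= M1 + M2.
    by rewrite mxE (le_trans (hM2 _ _ _ ht1))// lerDr ltW.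
  have lh := hL x _ _ g1 g2; have lk := hK x _ g1; have lm := hN t x ht1.
  have E : \sum_j `|tpartial j (v t) x| =
      \sum_j `|grad (u1 t) x ord0 j - grad (u2 t) x ord0 j|.
    by apply: eq_bigr => j _; have [_ ->] := dv j x ht0; rewrite !mxE.
  rewrite addr0 E /W /n; move: lh lk lm.
  move: ('D_(ee i) (H x) (grad (u1 t) x)) ('D_(ee i) (H x) (grad (u2 t) x)).
  move=> p q; move: (m1 t x) (m2 t x) (\sum_j _) => a b S lh lk lm.
  have -> : a * p - b * q = p * (a - b) + b * (p - q) by ring.
  rewrite (le_trans (ler_normD _ _))// !normrM lerD//; first by rewrite ler_wpM2r.
  by rewrite -mulrA ler_pM.
apply: le_trans (tint_sqr_bound cW cnt cG _ _ _ pw) _ => //.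
- exact: ltW.
- by rewrite mulr_ge0// ltW.
rewrite expr0n/= mulr0 addr0 -/(energy t) -/(mass t).
have E0 := energy_ge0 t; have k0 := mass_ge0 t.
move: (energy t) (mass t) E0 k0 => E k E0 k0.
have a0 : 0 <= 3 * K ^+ 2 by apply: mulr_ge0 => //; exact: sqr_ge0.
have b0 : 0 <= 3 * (N * L) ^+ 2 * d%:R.
  by apply: mulr_ge0 => //; apply: mulr_ge0 => //; exact: sqr_ge0.
move: (3 * K ^+ 2) (3 * (N * L) ^+ 2 * d%:R) a0 b0 => a b a0 b0.
rewrite mulrDr !mulrDl; have := mulr_ge0 a0 E0; have := mulr_ge0 b0 k0; lra.
Qed.

Let dtn_equation t x : t0 < t < T ->
  'D_1 (n ^~ x) t = laplacian (n t) x + \sum_i tpartial i (W i t) x.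
Proof.
move=> ht.
have [_ [_ C1] _ pde1 _] := S1; have [_ [_ C2] _ pde2 _] := S2.
have [_ e1] := pde1 t x ht; have [_ e2] := pde2 t x ht.
have e3 := dtn x ht; have e4 := lapB 0 x C1 C2 ht.
have e4' : laplacian (n t) x = laplacian (m1 t) x - laplacian (m2 t) x.
  have n0' : n t = (fun y => m1 t y - m2 t y - 0) by apply/funext => y; rewrite subr0.
  exact: etrans (congr1 (fun p => laplacian p x) n0') e4.
have divE (u m : R -> TT -> R) :
    divergence (fun y => m t y *: grad_p H y (grad (u t) y)) x =
    \sum_i tpartial i (fun y => m t y * 'D_(ee i) (H y) (grad (u t) y)) x.
  rewrite divergenceE; apply: eq_bigr => i _; congr tpartial.
  by apply/funext => y; rewrite !mxE.
have WE : \sum_i tpartial i (W i t) x =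
    \sum_i tpartial i (fun y => m1 t y * 'D_(ee i) (H y) (grad (u1 t) y)) x -
    \sum_i tpartial i (fun y => m2 t y * 'D_(ee i) (H y) (grad (u2 t) y)) x.
  rewrite -sumrB; apply: eq_bigr => i _.
  have [_ d1 _] := flux_slice i S1 hH ht; have [_ d2 _] := flux_slice i S2 hH ht.
  by have [_ ->] := tpartialB (d1 x) (d2 x).
exact: subtract_equations e3 e4' WE (divE u1 m1) (divE u2 m2) e1 e2.
Qed.

(** Integration by parts moves all derivatives onto n, and the dissipation
    - 2 |Dn|^2 absorbs them: no second derivative of v is left. *)
Let mass_derivative t : t0 < t < T ->
  2 * tint (fun x => 'D_1 (n ^~ x) t * n t x) <=
  \sum_i tint (fun x => W i t x ^+ 2) / 2.
Proof.
move=> ht; have snt := Sn ht; have [cnt pn] := snt.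
have fl i : [/\ continuous (W i t), forall x, tderivable i (W i t) x &
    continuous (tpartial i (W i t))].
  have [c1 d1 p1] := flux_slice i S1 hH ht; have [c2 d2 p2] := flux_slice i S2 hH ht.
  split; first exact: contB c1 c2.
    by move=> x; have [] := tpartialB (d1 x) (d2 x).
  rewrite (_ : tpartial i (W i t) = (fun x =>
    tpartial i (fun y => m1 t y * 'D_(ee i) (H y) (grad (u1 t) y)) x -
    tpartial i (fun y => m2 t y * 'D_(ee i) (H y) (grad (u2 t) y)) x)).
    exact: contB p1 p2.
  by apply/funext => x; have [_ ->] := tpartialB (d1 x) (d2 x).
have cl := contN (laplacian_continuous snt).
have cnl := contM cnt cl.
have cnW i : continuous (fun x => n t x * tpartial i (W i t) x).
  by have [_ _ p] := fl i; exact: contM cnt p.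
have cS : continuous (fun x => \sum_i n t x * tpartial i (W i t) x).
  by apply: continuous_sumr => i; exact: cnW.
have e1 : tint (fun x => 'D_1 (n ^~ x) t * n t x) =
    tint (fun x => \sum_i n t x * tpartial i (W i t) x) -
    tint (fun x => n t x * - laplacian (n t) x).
  apply: etrans (tintB cS cnl); congr tint; apply/funext => x.
  rewrite dtn_equation// -mulr_sumr.
  have F (a b p : R) : (a + b) * p = p * b - p * - a by ring.
  exact: F.
have e2 : tint (fun x => \sum_i n t x * tpartial i (W i t) x) =
    \sum_i - tint (fun x => W i t x * tpartial i (n t) x).
  apply: etrans (tint_sum cnW) _; apply: eq_bigr => i _.
  have [c1 d1 p1] := fl i; have [dn cdn _ _] := pn i.
  exact: (tint_by_parts cnt c1 dn d1 cdn p1).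
have e3 := tint_green snt snt.
rewrite e1 e2 e3 -sumrB mulr_sumr; apply: ler_sum => i _.
have [c1 _ _] := fl i; have [_ cdn _ _] := pn i.
have := tint_quadratic_ge0 2 c1 cdn.
have -> : tint (fun x => tpartial i (n t) x ^+ 2) =
    tint (fun x => tpartial i (n t) x * tpartial i (n t) x).
  by congr tint; apply/funext => x; rewrite expr2.
exact: half_square_le.
Qed.

Let jv : jcontinuous `]t0, T[ v.
Proof. by apply: jcontS cv => s /=; rewrite !in_itv/= => /andP[/ltW -> /ltW ->]. Qed.

Let jn : jcontinuous `]t0, T[ n.
Proof. by apply: jcontS cn => s /=; rewrite !in_itv/= => /andP[/ltW -> /ltW ->]. Qed.

Let norm2 t := tint (fun x => v t x ^+ 2).

Let dynamics t1 : t0 < t1 < T -> exists C : R, 0 <= C /\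
  forall t, t0 < t < t1 -> exists B a e hh dk,
    [/\ is_derive t (1 : R) norm2 (2 * a + e),
        is_derive t (1 : R) energy (2 * B - hh / 2) &
        is_derive t (1 : R) mass dk] /\
    [/\ energy t = a - e / 2, forall psi, 0 <= B - 2 * psi * a + psi ^+ 2 * norm2 t,
        forall g, 0 <= hh + 4 * g * e + 4 * g ^+ 2 * norm2 t,
        hh <= C * (energy t + mass t) & dk <= C * (energy t + mass t)].
Proof.
move=> t1b; have [C1 C10 hC1] := source_bound t1b.
have /choice[C2 hC2] : forall i, exists C : R, 0 <= C /\ forall t, t0 < t < t1 ->
    tint (fun x => W i t x ^+ 2) <= C * (energy t + mass t).
  by move=> i; exact: W_bound.
have C2s : 0 <= \sum_i C2 i / 2.
  by apply: sumr_ge0 => i _; rewrite divr_ge0//; have [] := hC2 i.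
exists (C1 + \sum_i C2 i / 2); split; first exact: addr_ge0.
move=> t ht1.
have ht : t0 < t < T.
  by case/andP: t1b => _ h; case/andP: ht1 => -> /lt_trans; apply.
have nI : nbhs t [set` `]t0, T[%R].
  have : t \in `]t0, T[%R by rewrite in_itv.
  exact: near_in_itvoo.
have svt := Sv ht; have cD := cD1 C12v ht; have cl := laplacian_continuous svt.
have Eg : energy t = tint (fun x => v t x * - laplacian (v t) x).
  apply: esym; apply: etrans (tint_green svt svt) _.
  by apply: eq_bigr => i _; congr tint; apply/funext => x; rewrite expr2.
have [B [a [e [h1 h2 h3 h4 h5]]]] := carleman_gram cD svt.1 cl Eg.
have dP := L2_is_derive nI jv C12v.
have dE := dirichlet_is_derive nI jv C12v.
have dk := L2_is_derive nI jn C12n.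
exists B, a, e, (tint (fun x => ('D_1 (v ^~ x) t + laplacian (v t) x) ^+ 2)).
exists (2 * tint (fun x => 'D_1 (n ^~ x) t * n t x)).
have EM0 : 0 <= energy t + mass t by exact: addr_ge0.
split.
  by split; [rewrite -h1; exact: dP|rewrite -h2; exact: dE|exact: dk].
split => //.
- apply: le_trans (hC1 t ht1) _; rewrite ler_wpM2r//; exact: ler_wpDr.
- apply: le_trans (mass_derivative ht) _.
  apply: (@le_trans _ _ ((\sum_i C2 i / 2) * (energy t + mass t))); last first.
    by rewrite ler_wpM2r//; exact: ler_wpDl.
  rewrite mulr_suml; apply: ler_sum => i _; rewrite mulrAC ler_wpM2r//.
  by have [_ /(_ t ht1)] := hC2 i.
Qed.

Let vanishing t : t0 < t < T -> forall x, v t x = 0 /\ n t x = 0.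
Proof.
move=> ht; pose t1 := (t + T) / 2.
have /andP[h0 h1] := ht.
have tt1 : t < t1 by rewrite /t1; lra.
have t1T : t1 < T by rewrite /t1; lra.
have t1b : t0 < t1 < T by rewrite (lt_trans h0 tt1).
have [C [C0 hC]] := dynamics t1b.
have sub : [set` `[t0, t1]%R] `<=` [set` `[t0, T]%R].
  by move=> s /=; rewrite !in_itv/= => /andP[-> /le_trans]; apply; exact: ltW.
have subG : [set` `[t0, t1]%R] `<=` [set` `[t0, T[%R].
  by move=> s /=; rewrite !in_itv/= => /andP[-> /le_lt_trans]; apply.
have jv1 := jcontS sub cv; have jn1 := jcontS sub cn.
have cP : {within `[t0, t1], continuous norm2} by exact: tint_continuous (jcontM jv1 jv1).
have ck : {within `[t0, t1], continuous mass} by exact: tint_continuous (jcontM jn1 jn1).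
have cE : {within `[t0, t1], continuous energy}.
  have ci i : {within `[t0, t1], continuous (fun s => tint (fun x => tpartial i (v s) x ^+ 2))}.
    have jG := jcontS subG (@cGv i).
    exact: tint_continuous (jcontM jG jG).
  apply/subspace_continuousP => s hs; apply: cvg_sumr => i.
  by have /subspace_continuousP := ci i; exact.
have tint0 (w : TT -> R) : (forall x, w x = 0) -> tint (fun x => w x ^+ 2) = 0.
  move=> w0; rewrite (_ : (fun x => _) = (fun=> 0)) ?tint_cst//.
  by apply/funext => x; rewrite w0 expr0n.
have [] := @carleman_gronwall R t0 t1 C norm2 energy mass _ C0 cP cE ck _ _ _ _ hC t.
- exact: lt_trans h0 tt1.
- exact: tint0 v0.
- by rewrite /energy big1// => i _; apply: tint0 => x; exact: Gv0.
- exact: tint0 n0.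
- by move=> s _; split => //; apply: tint_ge0 => x; exact: sqr_ge0.
- by rewrite h0.
move=> P0 k0 x.
have zero (w : TT -> R) : continuous w -> tint (fun x => w x ^+ 2) = 0 -> w x = 0.
  move=> cw w0; apply/eqP; rewrite -sqrf_eq0; apply/eqP.
  exact: (tint_eq0 (phi := fun x => w x ^+ 2) (contM cw cw) (fun y => sqr_ge0 _) w0 x).
by split; apply: zero => //; [have [] := Sv ht|have [] := Sn ht].
Qed.

(** Continuity carries v = 0 and n = 0 to the time T, where the terminal condition
    of u determines c. *)
Lemma mfg_solution_unique : lipschitz_TP g ->
  forall t x, t0 <= t <= T -> u1 t x = u2 t x /\ m1 t x = m2 t x.
Proof.
move=> hg.
have nz t x : t0 <= t < T -> v t x = 0 /\ n t x = 0.
  rewrite le_eqVlt => /andP[/predU1P[<- _|h0 h1]]; first by rewrite v0 n0.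
  by apply: vanishing; rewrite h0.
have nT x : n T x = 0.
  by apply: (jcont_zero_end t0T cn) => s y hs; have [_ ->] := nz s y hs.
have vT x : v T x = 0.
  by apply: (jcont_zero_end t0T cv) => s y hs; have [-> _] := nz s y hs.
have hT : t0 <= T <= T by rewrite ltW//=.
have [L L0 hL] := coupling_le hg.
have c0 : c = 0.
  have [_ _ den1 _ [_ g1]] := S1; have [_ _ den2 _ [_ g2]] := S2.
  have := hL (tproj 0) _ _ _ _ (den1 T hT) (den2 T hT) (cm1 hT) (cm2 hT).
  rewrite (_ : (fun y => _) = (fun=> 0)); last first.
    by apply/funext => y; rewrite -/(n T y) nT normr0.
  rewrite tint_cst mulr0 normr_le0 subr_eq0 -g1 -g2 => /eqP e.
  by have := vT (tproj 0); rewrite /v e subrr sub0r => /eqP; rewrite oppr_eq0 => /eqP.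
have all t x : t0 <= t <= T -> v t x = 0 /\ n t x = 0.
  rewrite [t <= T]le_eqVlt => /andP[h0 /predU1P[->|h1]]; first by rewrite vT nT.
  by apply: nz; rewrite h0.
move=> t x /(all t x)[]; rewrite /v /n c0 subr0 => /eqP h1 /eqP h2.
by move: h1 h2; rewrite !subr_eq0 => /eqP -> /eqP ->.
Qed.

End Solutions.

Theorem proposition2p1 (R : realType) (d : nat) (hd : (0 < d)%N)
    (T t0 : R) (hT : 0 < T) (ht0 : 0 <= t0 <= T)
    (H : torus R d -> 'rV[R]_d -> R) (hH : hamiltonian H)
    (f g : torus R d -> probability (torus R d) R -> R)
    (hf : coupling_C1 f) (hg : coupling_C2 g)
    (m0 : torus R d -> R) (hm0 : is_density m0)
    (u1 m1 u2 m2 : R -> torus R d -> R)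
    (hsol1 : mfg_solution H f g t0 T m0 u1 m1)
    (hsol2 : mfg_solution H f g t0 T m0 u2 m2)
    (hDu : forall x : torus R d, grad (u1 t0) x = grad (u2 t0) x) :
  forall (t : R) (x : torus R d), t0 <= t <= T ->
    u1 t x = u2 t x /\ m1 t x = m2 t x.
Proof.
have [mu1 S1] := hsol1; have [mu2 S2] := hsol2.
have [lf _ _] := hf; have [[lg _ _] _] := hg; have [C2H _] := hH.
have /andP[_ t0T] := ht0.
have [tT|tT] := ltP t0 T.
  exact: (mfg_solution_unique S1 S2 tT C2H lf hDu lg).
(* A horizon reduced to a point leaves only the initial and terminal data. *)
have eT : t0 = T by apply/eqP; rewrite eq_le t0T.
have [_ [c1 _] den1 _ [i1 g1]] := S1; have [_ [c2 _] den2 _ [i2 g2]] := S2.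
have It : [set` `[t0, T]%R] T by rewrite /= in_itv/= eT lexx.
have hTT : t0 <= T <= T by rewrite eT lexx.
have mE x : m1 T x = m2 T x by rewrite -eT i1 i2.
have [L L0 hL] := coupling_le lg.
move=> t x /andP[h0 h1]; have -> : t = T by apply/eqP; rewrite eq_le h1 -eT h0.
split => //; rewrite g1 g2; apply/eqP; rewrite -subr_eq0 -normr_le0.
have := hL x _ _ _ _ (den1 T hTT) (den2 T hTT)
  (jcontinuous_slice c1 It) (jcontinuous_slice c2 It).
rewrite (_ : (fun y => _) = (fun=> 0)) ?tint_cst ?mulr0//.
by apply/funext => y; rewrite mE subrr normr0.
Qed.
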